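(* Let $N\subset\mathbb{C}^2$ be a real-analytic hypersurface through the origin, graphed near $0$ as \[ v\,=\,F(z,\overline{z},u)\,=\,z\overline{z}+F_{3,2,0}\,z^3\overline{z}^2+\overline{F}_{3,2,0}\,z^2\overline{z}^3+\mathrm{O}(6) \] (weighted remainder), with $F_{3,2,0}\in\mathbb{C}$ and $F(0,0,u)\equiv 0$. If the $u$-axis $\{(z,w)=(0,u)\colon u\in\mathbb{R}\}$, contained in $N$, is a Moser chain of $N$, then $F_{3,2,0}=0$.
   Context: Coordinates on $\mathbb{C}^2$ are $(z,w)=(x+iy,u+iv)$, with weights $[z]=[\overline{z}]=1$, $[w]=[\overline{w}]=2$, $[u]=2$. $\mathrm{O}(6)$ denotes a convergent power series in $(z,\overline{z},u)$ whose monomials $z^j\overline{z}^ku^l$ all satisfy $j+k+2l\geqslant 6$. Moser chains. Let $M\subset\mathbb{C}^2$ be a real-analytic Levi nondegenerate hypersurface, i.e. $T^cM+[T^cM,T^cM]=TM$ with $T^cM=TM\cap J\,TM$, $J$ the standard complex structure. A curve in $M$ through $q$ is CR-transversal at $q$ if its tangent at $q$ is not in $T^c_qM$; $J^2_{M,q}$ denotes the space of $2$-jets at $q$ of unparametrized curves in $M$ through $q$ which are CR-transversal at $q$. A local biholomorphism $\varphi$ sending $(M,q)$ to $(N',q')$ induces a diffeomorphism $\varphi^{(2)}\colon J^2_{M,q}\to J^2_{N',q'}$. A normalizing map of $M$ at $q=(z_q,w_q)$ is a composition $\varphi=\Phi_q\circ\tau_q$, where $\tau_q\colon(z,w)\mapsto(z-z_q,w-w_q)$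 and $\Phi_q$ is a local biholomorphism fixing $0$ which sends $\tau_q(M)$ to a hypersurface $N^q$ of equation $v=z\overline{z}+\mathrm{O}(6)$; such maps always exist. On $N^q$, CR-transversal curves through $0$ are graphs $u\mapsto(x(u),y(u))$ in the coordinates $(u,x,y)$ of $N^q$, and $J^2_{N^q,0}\cong\mathbb{R}^4$ has coordinates $(x_1,y_1,x_2,y_2)=(\dot x(0),\dot y(0),\ddot x(0),\ddot y(0))$. Let $\Sigma_0:=\{x_2=-2x_1^2y_1-2y_1^3,\ y_2=2x_1y_1^2+2x_1^3\}\subset J^2_{N^q,0}$ and $\Sigma_q:=(\varphi^{(2)})^{-1}(\Sigma_0)\subset J^2_{M,q}$, which does not depend on the normalizing map $\varphi$. In coordinates $(u,x,y)$ on $M$, the surfaces $\Sigma_q$ are given by two real-analytic equations $x_2=A(u,x,y,x_1,y_1)$, $y_2=B(u,x,y,x_1,y_1)$, and a Moser chain is a solution $u\mapsto(x(u),y(u))$ of the system $\ddot x=A(u,x,y,\dot x,\dot y)$, $\ddot y=B(u,x,y,\dot x,\dot y)$; equivalently, a Moser chain is a real-analytic CR-transversal curve in $M$ whose $2$-jet at each of its points $q$ belongs to $\Sigma_q$. *)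

(* Defs.v *)
From Stdlib Require Export Reals List.
From Coquelicot Require Export Coquelicot.
Export ListNotations.
Open Scope R_scope.

(** * Convergent power series in several variables

    A power series in [n] variables is a family [c] of complex coefficients
    indexed by multi-indices, i.e. lists of length [n]; a point is the list of
    the values of the variables. *)

(* [psum c m [x1; ..; xn]] is the sum of [c [j1; ..; jn] x1^j1 .. xn^jn] over
   all multi-indices with [j1, .., jn <= m]. *)
Fixpoint psum (c : list nat -> C) (m : nat) (x : list C) : C :=
  match x with
  | [] => c []
  | x1 :: x' =>
      sum_n (fun j => Cmult (Cpow x1 j) (psum (fun J => c (j :: J)) m x')) m
  end.

Definition psum_lim (c : list nat -> C) (x : list C) (s : C) : Prop :=
  filterlim (fun m => psum c m x) eventually (locally s).

(* Cauchy estimates: they give absolute convergence on the open polydisc of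
   radius [r], where [psum_lim] is therefore the unordered sum. *)
Definition convergent (n : nat) (c : list nat -> C) (r : R) : Prop :=
  0 < r /\
  exists B : R, forall J : list nat, length J = n ->
    Cmod (c J) * r ^ list_sum J <= B.

(** * Points, holomorphic maps and analytic objects in C^2 *)

(* A point is [(z, w)] with [z = x + i y] and [w = u + i v]. *)
Definition C2 : Type := (C * C)%type.

Definition origin : C2 := (RtoC 0, RtoC 0).
Definition add2 (p q : C2) : C2 := (Cplus (fst p) (fst q), Cplus (snd p) (snd q)).
Definition sub2 (p q : C2) : C2 := (Cminus (fst p) (fst q), Cminus (snd p) (snd q)).
Definition scal2 (a : C) (p : C2) : C2 := (Cmult a (fst p), Cmult a (snd p)).

Definition holomorphic_at (f : C2 -> C) (p : C2) : Prop :=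
  exists (c : list nat -> C) (r : R), convergent 2 c r /\
    forall z w : C, Cmod z < r -> Cmod w < r ->
      psum_lim c [z; w] (f (add2 p (z, w))).

Definition holomorphic_map_at (f : C2 -> C2) (p : C2) : Prop :=
  holomorphic_at (fun q => fst (f q)) p /\ holomorphic_at (fun q => snd (f q)) p.

(* Maps are total; only the values of [Phi] near [p] are meaningful. *)
Definition local_biholomorphism (Phi : C2 -> C2) (p : C2) : Prop :=
  exists (Psi : C2 -> C2) (U V : C2 -> Prop),
    open U /\ open V /\ U p /\
    (forall q, U q -> V (Phi q) /\ Psi (Phi q) = q) /\
    (forall q, V q -> U (Psi q) /\ Phi (Psi q) = q) /\
    (forall q, U q -> holomorphic_map_at Phi q) /\
    (forall q, V q -> holomorphic_map_at Psi q).

Definition analytic_function_at (rho : C2 -> R) (p : C2) : Prop :=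
  exists (c : list nat -> C) (r : R), convergent 4 c r /\
    forall x y u v : R, Rabs x < r -> Rabs y < r -> Rabs u < r -> Rabs v < r ->
      psum_lim c [RtoC x; RtoC y; RtoC u; RtoC v]
        (RtoC (rho (add2 p ((x, y), (u, v))))).

Definition analytic_path_at (f : R -> C) (t : R) : Prop :=
  exists (c : list nat -> C) (r : R), convergent 1 c r /\
    forall h : R, Rabs h < r -> psum_lim c [RtoC h] (f (t + h)).

Definition analytic_curve_at (gamma : R -> C2) (t : R) : Prop :=
  analytic_path_at (fun s => fst (gamma s)) t /\
  analytic_path_at (fun s => snd (gamma s)) t.

(** * Hypersurfaces *)

(* Not required to be closed in C^2. *)
Definition analytic_hypersurface (M : C2 -> Prop) : Prop :=
  forall q, M q ->
    exists rho : C2 -> R, analytic_function_at rho q /\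
      (exists (v : C2) (d : R),
          is_derive (fun t : R => rho (add2 q (scal2 (RtoC t) v))) 0 d /\ d <> 0) /\
      locally (q : C * C) (fun p : C * C => M p <-> rho p = 0).

(* Near the origin, [M] is the graph [v = F(z, zbar, u)]. *)
Definition graphed_at_origin (M : C2 -> Prop) (F : C -> R -> R) : Prop :=
  locally (origin : C * C)
    (fun p : C * C => M p <-> Im (snd p) = F (fst p) (Re (snd p))).

(* [G(z, u) = O(6)], where [z, zbar] have weight 1 and [u] has weight 2. *)
Definition weighted_O6 (G : C -> R -> C) : Prop :=
  exists (c : list nat -> C) (r : R), convergent 3 c r /\
    (forall j k l : nat, c [j; k; l] <> RtoC 0 -> (6 <= j + k + 2 * l)%nat) /\
    forall (z : C) (u : R), Cmod z < r -> Rabs u < r ->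
      psum_lim c [z; Cconj z; RtoC u] (G z u).

(* [v = z zbar + O(6)] *)
Definition normal_at_origin (M : C2 -> Prop) : Prop :=
  exists F : C -> R -> R,
    graphed_at_origin M F /\
    weighted_O6 (fun z u => (RtoC (F z u) - z * Cconj z)%C).

(** * CR-transversal curves *)

Definition tangent (M : C2 -> Prop) (q v : C2) : Prop :=
  exists c : R -> C2,
    c 0 = q /\ locally 0 (fun t : R => M (c t)) /\
    is_derive (c : R -> C * C) 0 (v : C * C).

(* [T^c M = TM /\ J TM], where [J] is multiplication by [i]. *)
Definition complex_tangent (M : C2 -> Prop) (q v : C2) : Prop :=
  tangent M q v /\ exists v' : C2, tangent M q v' /\ v = scal2 Ci v'.

Definition CR_transversal (M : C2 -> Prop) (gamma : R -> C2) (t : R) : Prop :=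
  exists v : C2,
    is_derive (gamma : R -> C * C) t (v : C * C) /\
    ~ complex_tangent M (gamma t) v.

(** * Moser chains *)

(* [phi = Phi o tau_q]. Levi nondegeneracy of [M] at [q] is necessary for
   normalizing maps to exist. *)
Definition normalizing_map (M : C2 -> Prop) (q : C2) (phi : C2 -> C2) : Prop :=
  exists Phi : C2 -> C2,
    (forall p, phi p = Phi (sub2 p q)) /\
    local_biholomorphism Phi origin /\
    Phi origin = origin /\
    exists Nq : C2 -> Prop,
      normal_at_origin Nq /\
      locally (origin : C * C)
        (fun p : C * C => M (add2 p q) <-> Nq (Phi p)).

Definition derivatives2 (f : R -> R) (s f1 f2 : R) : Prop :=
  locally s (fun s' : R => ex_derive f s') /\
  is_derive f s f1 /\ is_derive (Derive f) s f2.

(* [sigma], with [sigma t = origin], is near [t] a reparametrization of a graph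
   [u |-> (x u, y u)] in the coordinates [(u, x, y)] of a hypersurface tangent
   to [v = 0]; its unparametrized 2-jet has coordinates [(x1, y1, x2, y2)]. *)
Definition graph_jet (sigma : R -> C2) (t x1 y1 x2 y2 : R) : Prop :=
  (exists d : R, is_derive (fun s : R => Re (snd (sigma s))) t d /\ d <> 0) /\
  exists x y : R -> R,
    locally t (fun s : R =>
      fst (sigma s) = (x (Re (snd (sigma s))), y (Re (snd (sigma s))))) /\
    derivatives2 x 0 x1 x2 /\ derivatives2 y 0 y1 y2.

Definition Sigma0 (x1 y1 x2 y2 : R) : Prop :=
  x2 = - 2 * x1 ^ 2 * y1 - 2 * y1 ^ 3 /\
  y2 = 2 * x1 * y1 ^ 2 + 2 * x1 ^ 3.

(* The 2-jet at [q = gamma t] of the CR-transversal curve [gamma] in [M] is in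
   [Sigma_q = (phi^(2))^-1 (Sigma0)]. Jets are handled through representatives:
   [phi^(2)] sends the 2-jet of [gamma] to that of [phi o gamma]. As [Sigma_q]
   does not depend on [phi], one normalizing map is enough. *)
Definition jet_in_Sigma (M : C2 -> Prop) (gamma : R -> C2) (t : R) : Prop :=
  exists phi : C2 -> C2,
    normalizing_map M (gamma t) phi /\
    exists x1 y1 x2 y2 : R,
      graph_jet (fun s => phi (gamma s)) t x1 y1 x2 y2 /\
      Sigma0 x1 y1 x2 y2.

(* The curve [gamma], restricted to the open interval [(a, b)]. *)
Definition Moser_chain (M : C2 -> Prop) (gamma : R -> C2) (a b : R) : Prop :=
  forall t, a < t < b ->
    M (gamma t) /\ analytic_curve_at gamma t /\
    CR_transversal M gamma t /\ jet_in_Sigma M gamma t.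

Definition u_axis (u : R) : C2 := (RtoC 0, RtoC u).

(* Main.v *)
Require Import Defs.
From Stdlib Require Import Reals List Lra Lia.
From Coquelicot Require Import Coquelicot.
Open Scope R_scope.

(** At the origin, the chain condition provides a holomorphic map
    [Phi = (f, g)] fixing the origin and sending [N] to a hypersurface
    [v = z zbar + O(6)], such that the 2-jet of [Phi (0, u)] lies in [Sigma0].
    Give [z] weight 1 and [w] weight 2. Below weight 6 the equation
    [Im g = |f| ^ 2], restricted to [N], involves finitely many Taylor
    coefficients of [f] and [g]; let [p.[j, k]] be those of [z ^ j w ^ k] in [f].
    Comparing the coefficients of [z ^ 3 zbar ^ 2], [z ^ 2 zbar u] and [z u ^ 2] in
    weight 5 and eliminating those of [g] and [p.[2, 1]] yields ([weight5_relation])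

      [|p.[1, 0]| ^ 2 F320 = - 4 p.[1, 0] (Cconj p.[0, 2])
          - 2 i p.[2, 0] (Cconj p.[1, 1]) + p.[3, 0] (Cconj p.[2, 0])].

    Weights 2, 3 and 4 determine [p.[2, 0]], [p.[3, 0]] and the imaginary part of
    [Cconj p.[1, 0] * p.[1, 1]] from [p.[1, 0]] and [p.[0, 1]]
    ([weight2_relation], [weight3_relation], [weight4_relation]).
    Thus [F320 = 0] is equivalent to an expression of [p.[0, 2]] in terms of
    [p.[1, 0]], [p.[0, 1]] and [Re (Cconj p.[1, 0] * p.[1, 1])], which is also the
    real part of the coefficient of [w ^ 2] in [g]. Since [p.[0, 1]], [p.[0, 2]]
    and the real parts of the coefficients of [w] and [w ^ 2] in [g] determine the
    2-jet of [Phi (0, u)], this is a condition on that 2-jet, and it is [Sigma0]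
    ([axis_jet_relations], [coefficient_vanishes]). One may divide by [p.[1, 0]],
    because [|p.[1, 0]| ^ 2] is the derivative at 0 of [Re g (0, u)], which is
    nonzero when the image of the axis is a graph over the real direction.

    To extract these coefficients, the equation is restricted to the real curves
    [z = zt s], [u = mu s ^ 2] of [N] with [s > 0], along which a weighted O(6)
    becomes [O(s ^ 6)]; both sides then have a Taylor expansion in [s] up to
    order 5 ([normal_image_relations]). The coefficient of [s ^ j] in each side
    is a polynomial in [zt], its conjugate and [mu], and monomials in these are
    linearly independent ([homogeneous5_zero], [quadratic_zero]). *)

Local Notation "p .[ j , k ]" := (p j%nat k%nat) (at level 2, left associativity,
  format "p .[ j ,  k ]").

(** * One-sided jets of functions of a real variable *)

(** Little-o of [s ^ n] as [s] decreases to [0]. One side suffices, since a jet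
    is determined by its germ there, and it lets [s] be replaced by [sqrt s]. *)
Definition small (n : nat) (h : R -> C) : Prop :=
  forall e : R, 0 < e -> at_right 0 (fun s => Cmod (h s) <= e * s ^ n).

(** Horner's form [a 0 + s (a 1 + s (..))]: its recursion removes the constant
    term, which is how all inductions on the order below proceed. *)
Fixpoint taylor (n : nat) (a : nat -> C) (s : R) : C :=
  match n with
  | O => a O
  | S m => (a O + RtoC s * taylor m (fun k => a (S k)) s)%C
  end.

Definition jet (n : nat) (h : R -> C) (a : nat -> C) : Prop :=
  small n (fun s => h s - taylor n a s)%C.

(** Coefficients of a product of power series. *)
Fixpoint conv (a b : nat -> C) (n : nat) : C :=
  match n with
  | O => (a O * b O)%C
  | S m => (a O * b (S m) + conv (fun k => a (S k)) b m)%C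
  end.

Lemma at_right_lt (d : R) : 0 < d -> at_right 0 (fun s => 0 < s < d).
Proof.
  intros hd. exists (mkposreal d hd). intros s hs hs0. split; [exact hs0|].
  unfold ball in hs; simpl in hs; unfold AbsRing_ball, abs, minus, plus, opp in hs.
  simpl in hs. rewrite Rabs_pos_eq in hs; lra.
Qed.

Lemma RtoC_neq0 (s : R) : 0 < s -> RtoC s <> 0.
Proof. intros hs E. apply RtoC_inj in E. lra. Qed.

Lemma small_ext_near (n : nat) (h k : R -> C) :
  at_right 0 (fun s => h s = k s) -> small n h -> small n k.
Proof.
  intros E H e he. generalize (filter_and _ _ E (H e he)).
  apply filter_imp. intros s [-> Hs]. exact Hs.
Qed.

Lemma small_plus (n : nat) (h k : R -> C) :
  small n h -> small n k -> small n (fun s => h s + k s)%C.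
Proof.
  intros H K e he.
  assert (he2 : 0 < e / 2) by lra.
  generalize (filter_and _ _ (H _ he2) (K _ he2)).
  apply filter_imp. intros s [Hs Ks].
  eapply Rle_trans; [apply Cmod_triangle|]. lra.
Qed.

Lemma small_mult_bounded (n : nat) (K : R) (h k : R -> C) :
  at_right 0 (fun s => Cmod (k s) <= K) -> small n h ->
  small n (fun s => k s * h s)%C.
Proof.
  intros HK H e he.
  assert (hK' : 0 < Rmax K 1) by (apply Rlt_le_trans with 1; [lra|apply Rmax_r]).
  assert (he' : 0 < e / Rmax K 1) by (apply Rdiv_lt_0_compat; assumption).
  generalize (filter_and _ _ HK (H _ he')).
  apply filter_imp. intros s [Ks Hs]. rewrite Cmod_mult.
  replace (e * s ^ n) with (Rmax K 1 * (e / Rmax K 1 * s ^ n)) by (field; lra).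
  apply Rmult_le_compat; try apply Cmod_ge_0; [|exact Hs].
  eapply Rle_trans; [exact Ks|apply Rmax_l].
Qed.

Lemma small_scal (n : nat) (c : C) (h : R -> C) :
  small n h -> small n (fun s => c * h s)%C.
Proof.
  apply (small_mult_bounded n (Cmod c)). apply filter_forall. intros; lra.
Qed.

Lemma small_bigO (n : nat) (K : R) (h : R -> C) :
  at_right 0 (fun s => Cmod (h s) <= K * s ^ S n) -> small n h.
Proof.
  intros H e he.
  assert (hK' : 0 < Rmax K 1) by (apply Rlt_le_trans with 1; [lra|apply Rmax_r]).
  assert (he' : 0 < e / Rmax K 1) by (apply Rdiv_lt_0_compat; assumption).
  generalize (filter_and _ _ H (at_right_lt _ he')).
  apply filter_imp. intros s [Hs [hs0 hs]].
  eapply Rle_trans; [exact Hs|].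
  assert (0 < s ^ n) by (apply pow_lt; lra).
  assert (Rmax K 1 * s <= e).
  { replace e with (Rmax K 1 * (e / Rmax K 1)) by (field; lra).
    apply Rmult_le_compat_l; lra. }
  simpl. rewrite <- Rmult_assoc. apply Rmult_le_compat_r; [lra|].
  eapply Rle_trans; [|exact H1]. apply Rmult_le_compat_r; [lra|apply Rmax_l].
Qed.

(** Dividing by [s] lowers the order of a jet by one; every statement about jets
    of arbitrary order is reduced by it to a statement about limits. *)
Lemma jet_S (n : nat) (h : R -> C) (a : nat -> C) :
  jet (S n) h a <->
  jet n (fun s => (h s - a O) / RtoC s)%C (fun k => a (S k)).
Proof.
  unfold jet, small. simpl taylor.
  split; intros H e he; generalize (filter_and _ _ (at_right_lt 1 Rlt_0_1) (H e he));
    apply filter_imp; intros s [[hs _] Hs]; clear H.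
  - assert (hs' : RtoC s <> 0) by (apply RtoC_neq0; lra).
    apply Rmult_le_reg_l with s; [exact hs|].
    rewrite <- (Rabs_pos_eq s) at 1 by lra. rewrite <- Cmod_R, <- Cmod_mult.
    replace (s * (e * s ^ n)) with (e * s ^ S n) by (simpl; ring).
    eapply Rle_trans; [|exact Hs]. right. f_equal. field. exact hs'.
  - assert (hs' : RtoC s <> 0) by (apply RtoC_neq0; lra).
    apply Rmult_le_compat_l with (r := s) in Hs; [|lra].
    rewrite <- (Rabs_pos_eq s) in Hs at 1 by lra. rewrite <- Cmod_R, <- Cmod_mult in Hs.
    replace (s * (e * s ^ n)) with (e * s ^ S n) in Hs by (simpl; ring).
    eapply Rle_trans; [|exact Hs]. right. f_equal. field. exact hs'.
Qed.

Lemma taylor_ext (n : nat) (a b : nat -> C) (s : R) :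
  (forall k, (k <= n)%nat -> a k = b k) -> taylor n a s = taylor n b s.
Proof.
  revert a b. induction n as [|n IH]; intros a b H; simpl.
  - apply H. lia.
  - rewrite (H O) by lia. f_equal. f_equal. apply IH. intros. apply H. lia.
Qed.

Lemma jet_coef_ext (n : nat) (h : R -> C) (a b : nat -> C) :
  (forall k, (k <= n)%nat -> a k = b k) -> jet n h a -> jet n h b.
Proof.
  intros E. apply small_ext_near, filter_forall. intros s.
  rewrite (taylor_ext n a b s E). reflexivity.
Qed.

Lemma jet_ext_near (n : nat) (h k : R -> C) (a : nat -> C) :
  at_right 0 (fun s => h s = k s) -> jet n h a -> jet n k a.
Proof.
  intros E. apply small_ext_near. revert E. apply filter_imp. intros s ->.
  reflexivity.
Qed.

Lemma jet_small (n : nat) (h k : R -> C) (a : nat -> C) :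
  small n (fun s => h s - k s)%C -> jet n k a -> jet n h a.
Proof.
  intros H K. generalize (small_plus _ _ _ H K).
  apply small_ext_near, filter_forall. intros s. ring.
Qed.

Lemma jet_taylor (n : nat) (a : nat -> C) : jet n (taylor n a) a.
Proof.
  intros e he. generalize (at_right_lt 1 Rlt_0_1). apply filter_imp.
  intros s [hs _]. replace (taylor n a s - taylor n a s)%C with (RtoC 0) by ring.
  rewrite Cmod_0. apply Rmult_le_pos; [lra|]. apply pow_le. lra.
Qed.

Lemma taylor_plus (n : nat) (a b : nat -> C) (s : R) :
  taylor n (fun k => a k + b k)%C s = (taylor n a s + taylor n b s)%C.
Proof.
  revert a b. induction n as [|n IH]; intros a b; simpl; [reflexivity|].
  rewrite (IH (fun k => a (S k)) (fun k => b (S k))). ring.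
Qed.

Lemma taylor_scal (n : nat) (c : C) (a : nat -> C) (s : R) :
  taylor n (fun k => c * a k)%C s = (c * taylor n a s)%C.
Proof.
  revert a. induction n as [|n IH]; intros a; simpl; [reflexivity|].
  rewrite (IH (fun k => a (S k))). ring.
Qed.

Lemma taylor_conj (n : nat) (a : nat -> C) (s : R) :
  taylor n (fun k => Cconj (a k)) s = Cconj (taylor n a s).
Proof.
  revert a. induction n as [|n IH]; intros a; simpl; [reflexivity|].
  rewrite (IH (fun k => a (S k))), Cplus_conj, Cmult_conj. f_equal. f_equal.
  apply injective_projections; simpl; lra.
Qed.

Lemma jet_plus (n : nat) (h k : R -> C) (a b : nat -> C) :
  jet n h a -> jet n k b -> jet n (fun s => h s + k s)%C (fun m => a m + b m)%C.
Proof.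
  intros H K. generalize (small_plus _ _ _ H K).
  apply small_ext_near, filter_forall. intros s. rewrite taylor_plus. ring.
Qed.

Lemma jet_scal (n : nat) (c : C) (h : R -> C) (a : nat -> C) :
  jet n h a -> jet n (fun s => c * h s)%C (fun m => c * a m)%C.
Proof.
  intros H. generalize (small_scal _ c _ H).
  apply small_ext_near, filter_forall. intros s. rewrite taylor_scal. ring.
Qed.

Lemma jet_conj (n : nat) (h : R -> C) (a : nat -> C) :
  jet n h a -> jet n (fun s => Cconj (h s)) (fun m => Cconj (a m)).
Proof.
  intros H e he. generalize (H e he). apply filter_imp. intros s Hs.
  rewrite taylor_conj, <- Cminus_conj, Cmod_conj. exact Hs.
Qed.

Lemma jet_le (n m : nat) (h : R -> C) (a : nat -> C) :
  (m <= n)%nat -> jet n h a -> jet m h a.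
Proof.
  revert m h a. induction n as [|n IH]; intros m h a hm H.
  - replace m with O by lia. exact H.
  - destruct m as [|m].
    (* [h - a 0 = s (h1 - a 1) + s a 1], where [h1 = (h - a 0) / s]
       tends to [a 1]. *)
    + apply jet_S in H. apply (IH O) in H; [|lia].
      unfold jet in *; simpl taylor in *.
      intros e he.
      assert (B : at_right 0 (fun s => Cmod (RtoC s) <= 1)).
      { generalize (at_right_lt 1 Rlt_0_1). apply filter_imp. intros s hs.
        rewrite Cmod_R, Rabs_pos_eq; lra. }
      assert (he2 : 0 < e / 2) by lra.
      assert (ha : 0 <= Cmod (a 1%nat)) by apply Cmod_ge_0.
      assert (hd : 0 < e / 2 / (Cmod (a 1%nat) + 1)) by (apply Rdiv_lt_0_compat; lra).
      generalize (filter_and _ _ (small_mult_bounded _ _ _ _ B H (e / 2) he2 : at_right 0 _)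
        (at_right_lt _ hd)).
      apply filter_imp. intros s [Hs [hs0 hs]]. simpl in Hs |- *.
      assert (hs' : RtoC s <> 0) by (apply RtoC_neq0; lra).
      replace (h s - a O)%C
        with (RtoC s * ((h s - a O) / RtoC s - a 1%nat) + RtoC s * a 1%nat)%C
        by (field; exact hs').
      eapply Rle_trans; [apply Cmod_triangle|].
      rewrite (Cmod_mult _ (a 1%nat)), Cmod_R, (Rabs_pos_eq s) by lra.
      assert (s * Cmod (a 1%nat) <= e / 2); [|lra].
      replace (e / 2) with (e / 2 / (Cmod (a 1%nat) + 1) * (Cmod (a 1%nat) + 1))
        by (field; lra).
      apply Rmult_le_compat; lra.
    + apply jet_S. apply jet_S in H. apply IH; [lia|exact H].
Qed.

Lemma jet_bound (n : nat) (h : R -> C) (a : nat -> C) :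
  jet n h a -> (forall k, (k < n)%nat -> a k = RtoC 0) ->
  exists K : R, 0 <= K /\ at_right 0 (fun s => Cmod (h s) <= K * s ^ n).
Proof.
  revert h a. induction n as [|n IH]; intros h a H Z.
  - assert (ha := Cmod_ge_0 (a O)). exists (1 + Cmod (a O)). split; [lra|].
    generalize (H 1 Rlt_0_1). apply filter_imp. intros s Hs. simpl in *.
    replace (h s) with (h s - a O + a O)%C by ring.
    eapply Rle_trans; [apply Cmod_triangle|]. lra.
  - apply jet_S in H. apply IH in H; [|intros; apply Z; lia].
    destruct H as [K [hK HK]]. exists K. split; [exact hK|].
    generalize (filter_and _ _ (at_right_lt 1 Rlt_0_1) HK). apply filter_imp.
    intros s [[hs0 _] Hs]. rewrite (Z O) in Hs by lia.
    assert (hs' : RtoC s <> 0) by (apply RtoC_neq0; lra).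
    replace (h s) with (RtoC s * ((h s - 0) / RtoC s))%C by (field; exact hs').
    rewrite Cmod_mult, Cmod_R, Rabs_pos_eq by lra. simpl.
    rewrite (Rmult_comm K), Rmult_assoc. apply Rmult_le_compat_l; [lra|].
    rewrite Rmult_comm. exact Hs.
Qed.

Lemma bound_weaken (n : nat) (h : R -> C) (K K' : R) :
  K <= K' -> at_right 0 (fun s => Cmod (h s) <= K * s ^ n) ->
  at_right 0 (fun s => Cmod (h s) <= K' * s ^ n).
Proof.
  intros hK H. generalize (filter_and _ _ (at_right_lt 1 Rlt_0_1) H).
  apply filter_imp. intros s [hs Hs]. eapply Rle_trans; [exact Hs|].
  apply Rmult_le_compat_r; [apply pow_le; lra|exact hK].
Qed.

(** The constant term is a limit, hence unique; the other ones follow by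
    division by [s]. *)
Lemma jet_unique (n : nat) (h : R -> C) (a b : nat -> C) :
  jet n h a -> jet n h b -> forall k, (k <= n)%nat -> a k = b k.
Proof.
  revert h a b. induction n as [|n IH]; intros h a b A B.
  - intros k hk. replace k with O by lia.
    destruct (Req_dec (Cmod (a O - b O)) 0) as [E|E].
    + apply Cmod_eq_0 in E. replace (a O) with (a O - b O + b O)%C by ring.
      rewrite E. ring.
    + exfalso. assert (P := Cmod_ge_0 (a O - b O)).
      set (e := Cmod (a O - b O)) in *.
      assert (he : 0 < e / 3) by lra.
      destruct (filter_ex _ (filter_and _ _ (A (e / 3) he) (B (e / 3) he)))
        as [s [As Bs]].
      simpl in As, Bs. rewrite Rmult_1_r in As, Bs.
      assert (e <= e / 3 + e / 3); [|lra].
      unfold e at 1.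
      replace (a O - b O)%C with ((h s - b O) + - (h s - a O))%C by ring.
      eapply Rle_trans; [apply Cmod_triangle|]. rewrite Cmod_opp. lra.
  - assert (E : a O = b O).
    { refine (IH h a b _ _ O _); [apply (jet_le (S n))|apply (jet_le (S n))|];
      try assumption; lia. }
    intros [|k] hk; [exact E|].
    apply jet_S in A. apply jet_S in B. rewrite <- E in B.
    apply (IH _ _ _ A B). lia.
Qed.

Lemma jet_const (n : nat) (c : C) : jet n (fun _ => c)
    (fun k => match k with O => c | _ => RtoC 0 end).
Proof.
  revert c. induction n as [|n IH]; intros c.
  - apply (jet_taylor 0 (fun k => match k with O => c | _ => RtoC 0 end)).
  - apply jet_S. eapply jet_coef_ext; [|eapply jet_ext_near; [|apply (IH (RtoC 0))]].
    + intros [|k] _; reflexivity.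
    + generalize (at_right_lt 1 Rlt_0_1). apply filter_imp. intros s hs.
      field. apply RtoC_neq0; lra.
Qed.

(** With [h = a 0 + s h1] and [k = b 0 + s k1], the quotient
    [(h k - a 0 b 0) / s] is [a 0 k1 + h1 k], whose jet is known by induction;
    this is also the recursion that defines [conv]. *)
Lemma jet_mult (n : nat) (h k : R -> C) (a b : nat -> C) :
  jet n h a -> jet n k b -> jet n (fun s => h s * k s)%C (conv a b).
Proof.
  revert h k a b. induction n as [|n IH]; intros h k a b H K.
  - destruct (jet_bound 0 k b K) as [B [_ HB]]; [intros; lia|].
    assert (HB' : at_right 0 (fun s => Cmod (k s) <= B)).
    { revert HB. apply filter_imp. intros s. simpl. rewrite Rmult_1_r. trivial. }
    generalize (small_plus _ _ _ (small_mult_bounded _ _ _ _ HB' H)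
                             (small_scal _ (a O) _ K)).
    apply small_ext_near, filter_forall. intros s. simpl. ring.
  - apply jet_S.
    assert (K' : jet n k b) by (apply (jet_le (S n)); [lia|exact K]).
    apply jet_S in H. apply jet_S in K.
    generalize (jet_plus _ _ _ _ _ (jet_scal _ (a O) _ _ K) (IH _ _ _ _ H K')).
    intros P. eapply jet_ext_near; [|eapply jet_coef_ext; [|exact P]].
    + generalize (at_right_lt 1 Rlt_0_1). apply filter_imp. intros s hs.
      simpl. field. apply RtoC_neq0; lra.
    + intros m _. reflexivity.
Qed.

Definition coefs (l : list C) (k : nat) : C := nth k l (RtoC 0).

(* Checks an equality of coefficients at each order up to 5. *)
Ltac coefwise :=
  let k := fresh "k" in let hk := fresh "hk" in
  intros k hk; unfold coefs;
  do 6 (destruct k as [|k]; [cbn; try ring|]); exfalso; lia.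

Lemma RtoC_Im (c : C) : RtoC (Im c) = (- (Ci * RtoC (/ 2)) * (c + - (1) * Cconj c))%C.
Proof. apply injective_projections; unfold Re, Im; simpl; field. Qed.

Lemma jet_Im (n : nat) (k : R -> C) (b : nat -> C) :
  jet n k b -> jet n (fun s => RtoC (Im (k s))) (fun j => RtoC (Im (b j))).
Proof.
  intros H.
  assert (T := jet_scal _ (- (Ci * RtoC (/ 2)))%C _ _ (jet_plus _ _ _ _ _ H
      (jet_scal _ (- (1))%C _ _ (jet_conj _ _ _ H)))).
  eapply jet_ext_near; [|eapply jet_coef_ext; [|exact T]].
  - apply filter_forall. intros s. rewrite RtoC_Im. reflexivity.
  - intros j _. rewrite RtoC_Im. reflexivity.
Qed.

Lemma RtoC_Re (c : C) : RtoC (Re c) = (RtoC (/ 2) * (c + Cconj c))%C.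
Proof. apply injective_projections; unfold Re, Im; simpl; field. Qed.

Lemma jet_Re (n : nat) (k : R -> C) (b : nat -> C) :
  jet n k b -> jet n (fun s => RtoC (Re (k s))) (fun j => RtoC (Re (b j))).
Proof.
  intros H.
  assert (T := jet_scal _ (RtoC (/ 2)) _ _ (jet_plus _ _ _ _ _ H (jet_conj _ _ _ H))).
  eapply jet_ext_near; [|eapply jet_coef_ext; [|exact T]].
  - apply filter_forall. intros s. rewrite RtoC_Re. reflexivity.
  - intros j _. rewrite RtoC_Re. reflexivity.
Qed.

(** * Weighted estimates for power series *)

(* [ring] for equalities stated in the group structure underlying [sum_n]. *)
Ltac cring := unfold plus; simpl; match goal with |- ?a = ?b => change (@eq C a b) end; ring.

(** Weight of the monomial with exponents [J], the variables having weights
    [om]. *)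
Fixpoint weight (om J : list nat) : nat :=
  match om, J with
  | k :: om', j :: J' => (k * j + weight om' J')%nat
  | _, _ => O
  end.

Lemma sum_n_geometric_bound (f : nat -> C) (A : R) (m : nat) :
  (forall j, Cmod (f j) <= A / 2 ^ j) -> Cmod (sum_n f m) <= 2 * A.
Proof.
  intros H.
  assert (hA : 0 <= A).
  { generalize (H O) (Cmod_ge_0 (f O)). simpl. rewrite Rdiv_1_r. lra. }
  assert (S : Cmod (sum_n f m) <= A * (2 - / 2 ^ m)).
  { induction m as [|m IH].
    - rewrite sum_O. generalize (H O). simpl. rewrite Rdiv_1_r, Rinv_1. lra.
    - rewrite sum_Sn. eapply Rle_trans; [apply Cmod_triangle|].
      generalize (H (S m)). unfold Rdiv.
      replace (/ 2 ^ S m) with (/ 2 ^ m / 2) by (simpl; field; apply pow_nonzero; lra).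
      lra. }
  eapply Rle_trans; [exact S|].
  assert (0 < / 2 ^ m) by (apply Rinv_0_lt_compat, pow_lt; lra).
  rewrite (Rmult_comm 2). apply Rmult_le_compat_l; lra.
Qed.

(** The hypotheses bound the term of index [J] by [A / 2 ^ (j1 + .. + jn)], so
    the sum is at most [A] times a product of [n] geometric series of sum 2. *)
Lemma psum_weighted_bound (om : list nat) (x : list C) (c : list nat -> C)
    (A tau : R) (m : nat) :
  0 < tau -> Forall2 (fun k xi => 2 * Cmod xi <= tau ^ k) om x ->
  (forall J, length J = length om -> Cmod (c J) * tau ^ weight om J <= A) ->
  Cmod (psum c m x) <= A * 2 ^ length om.
Proof.
  intros ht X. revert c A. induction X as [|k xi om x hx X IH]; intros c A H.
  - generalize (H [] eq_refl). simpl. lra.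
  - change (Cmod (sum_n (fun j => Cmult (Cpow xi j) (psum (fun J => c (j :: J)) m x)) m)
      <= A * (2 * 2 ^ length om)).
    replace (A * (2 * 2 ^ length om)) with (2 * (A * 2 ^ length om)) by ring.
    apply sum_n_geometric_bound. intros j.
    assert (hk : 0 < tau ^ (k * j)) by (apply pow_lt; exact ht).
    assert (h2 : 0 < 2 ^ j) by (apply pow_lt; lra).
    assert (B : Cmod (psum (fun J => c (j :: J)) m x)
                <= A / tau ^ (k * j) * 2 ^ length om).
    { apply IH. intros J hJ. apply Rmult_le_reg_r with (tau ^ (k * j)); [exact hk|].
      replace (A / tau ^ (k * j) * tau ^ (k * j)) with A by (field; lra).
      generalize (H (j :: J) ltac:(simpl; congruence)). simpl weight.
      rewrite pow_add. lra. }
    assert (hp : Cmod xi ^ j <= tau ^ (k * j) / 2 ^ j).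
    { apply Rmult_le_reg_l with (2 ^ j); [exact h2|].
      replace (2 ^ j * (tau ^ (k * j) / 2 ^ j)) with (tau ^ (k * j)) by (field; lra).
      rewrite <- Rpow_mult_distr, pow_mult. apply pow_incr.
      split; [|exact hx]. generalize (Cmod_ge_0 xi). lra. }
    rewrite Cmod_mult, Cmod_pow.
    replace (A * 2 ^ length om / 2 ^ j)
      with (tau ^ (k * j) / 2 ^ j * (A / tau ^ (k * j) * 2 ^ length om)) by (field; lra).
    apply Rmult_le_compat; try assumption; [|apply Cmod_ge_0].
    apply pow_le, Cmod_ge_0.
Qed.

Lemma psum_lim_close (c : list nat -> C) (x : list C) (s p : C) (K : R) :
  psum_lim c x s ->
  eventually (fun m => Cmod (psum c m x - p) <= K) -> Cmod (s - p) <= K.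
Proof.
  intros L E.
  apply Rnot_lt_le. intros hlt.
  set (e := (Cmod (s - p) - K) / 2).
  assert (he : 0 < e) by (unfold e; lra).
  (* The balls of [C] are squares, which costs a factor [sqrt 2]. *)
  assert (B : locally s (fun y : C => Cmod (y - s) < sqrt 2 * e)).
  { exists (mkposreal e he). intros y hy.
    exact (C_NormedModule_mixin_compat2 s y (mkposreal e he) hy). }
  destruct (filter_ex _ (filter_and _ _ E (L _ B))) as [m [H1 H2]].
  assert (T : Cmod (s - p) <= Cmod (psum c m x - p) + Cmod (psum c m x - s)).
  { replace (s - p)%C with ((psum c m x - p) + - (psum c m x - s))%C by ring.
    eapply Rle_trans; [apply Cmod_triangle|]. rewrite Cmod_opp. lra. }
  assert (sqrt 2 < 2).
  { replace 2 with (sqrt (2 * 2)) at 2 by (apply sqrt_square; lra).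
    apply sqrt_lt_1; lra. }
  assert (sqrt 2 * e < 2 * e) by (apply Rmult_lt_compat_r; lra).
  unfold e in *. lra.
Qed.

Lemma weight_ge (om J : list nat) :
  List.Forall (fun k => (1 <= k)%nat) om -> length J = length om ->
  (list_sum J <= weight om J)%nat.
Proof.
  intros H. revert J. induction H as [|k om hk H IH]; intros [|j J] hJ;
    simpl in *; try lia.
  assert (list_sum J <= weight om J)%nat by (apply IH; lia). nia.
Qed.

Lemma pow_le_1_antitone (t : R) (m n : nat) :
  0 <= t <= 1 -> (m <= n)%nat -> t ^ n <= t ^ m.
Proof.
  intros ht h. replace n with (m + (n - m))%nat by lia. rewrite pow_add.
  rewrite <- (Rmult_1_r (t ^ m)) at 2.
  apply Rmult_le_compat_l; [apply pow_le; lra|].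
  rewrite <- (pow1 (n - m)). apply pow_incr. lra.
Qed.

(** A power series [d] whose coefficients are those of [c] in weights at least
    [N], or zero, is [O(s ^ N)] when the variable of weight [k] is [O(s ^ k)].
    By the Cauchy estimates, with [r1 <= min(r, 1)], the term of index [J] is at
    most [B (s / r1) ^ weight J]; the factor 2 in [2 s / r1] leaves room for the
    geometric series of the previous bound. The constants depend on [c] alone. *)
Lemma psum_weighted_order (om : list nat) (c : list nat -> C) (r : R) (N : nat) :
  List.Forall (fun k => (1 <= k)%nat) om -> convergent (length om) c r ->
  exists K rho : R, 0 < rho <= 1 /\ rho <= r /\
  forall d : list nat -> C,
    (forall J, length J = length om ->
       d J = RtoC 0 \/ (d J = c J /\ (N <= weight om J)%nat)) ->
    forall (s : R) (x : list C) (m : nat), 0 < s < rho ->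
    Forall2 (fun k xi => Cmod xi <= s ^ k) om x ->
    Cmod (psum d m x) <= K * s ^ N.
Proof.
  intros hom [hr [B HB]].
  set (r1 := Rmin r 1).
  assert (hr1 : 0 < r1 <= 1).
  { unfold r1. split; [apply Rmin_glb_lt; lra|apply Rmin_r]. }
  exists (Rmax B 0 * (2 / r1) ^ N * 2 ^ length om), (r1 / 2).
  split; [lra|]. split.
  { generalize (Rmin_l r 1). fold r1. lra. }
  intros d Hd s x m hs hx.
  replace (Rmax B 0 * (2 / r1) ^ N * 2 ^ length om * s ^ N)
    with (Rmax B 0 * (2 * s / r1) ^ N * 2 ^ length om).
  2:{ replace (2 * s / r1) with (2 / r1 * s) by (field; lra).
      rewrite Rpow_mult_distr. ring. }
  assert (ht : 0 <= 2 * s / r1 <= 1).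
  { split; [apply Rdiv_le_0_compat; lra|].
    apply Rmult_le_reg_r with r1; [lra|].
    replace (2 * s / r1 * r1) with (2 * s) by (field; lra). lra. }
  apply (psum_weighted_bound om x d _ (2 * s)); [lra| |].
  - clear -hx hom hs. induction hx as [|k xi om x h hx IH]; constructor.
    + apply Forall_inv in hom. destruct k as [|k]; [lia|].
      simpl in *. rewrite Rmult_assoc. apply Rmult_le_compat_l; [lra|].
      eapply Rle_trans; [exact h|]. apply Rmult_le_compat_l; [lra|].
      apply pow_incr. lra.
    + apply IH. exact (Forall_inv_tail hom).
  - intros J hJ.
    assert (P : 0 <= Rmax B 0 * (2 * s / r1) ^ N).
    { apply Rmult_le_pos; [apply Rmax_r|]. apply pow_le. lra. }
    destruct (Hd J hJ) as [->|[-> hw]].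
    + rewrite Cmod_0. lra.
    + assert (E : Cmod (c J) * r1 ^ weight om J <= Rmax B 0).
      { eapply Rle_trans; [|apply Rmax_l]. eapply Rle_trans; [|apply (HB J hJ)].
        apply Rmult_le_compat_l; [apply Cmod_ge_0|].
        eapply Rle_trans; [apply pow_le_1_antitone; [lra|apply weight_ge; eassumption]|].
        apply pow_incr. split; [lra|apply Rmin_l]. }
      replace (2 * s) with (r1 * (2 * s / r1)) at 1 by (field; lra).
      rewrite Rpow_mult_distr, <- Rmult_assoc.
      apply Rmult_le_compat; try assumption.
      * apply Rmult_le_pos; [apply Cmod_ge_0|]. apply pow_le. lra.
      * apply pow_le. lra.
      * apply pow_le_1_antitone; assumption.
Qed.

(** The form in which weighted remainders are used: [z = O(s)], [u = O(s ^ 2)]. *)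
Lemma weighted_O6_estimate (G : C -> R -> C) :
  weighted_O6 G ->
  exists K rho : R, 0 < rho /\
  forall (s : R) (z : C) (u : R), 0 < s < rho -> Cmod z <= s -> Rabs u <= s ^ 2 ->
    Cmod (G z u) <= K * s ^ 6.
Proof.
  intros (c & r & hc & hw & hG).
  destruct (psum_weighted_order [1; 1; 2]%nat c r 6) as (K & rho & hrho & hrr & H).
  - repeat constructor.
  - exact hc.
  - exists K, rho. split; [lra|]. intros s z u hs hz hu.
    assert (hs2 : s ^ 2 <= s) by (simpl; rewrite <- (Rmult_1_r s) at 3; apply Rmult_le_compat_l; lra).
    replace (G z u) with (G z u - 0)%C by ring.
    apply (psum_lim_close c [z; Cconj z; RtoC u]).
    + apply hG; lra.
    + apply filter_forall. intros m.
      replace (psum c m [z; Cconj z; RtoC u] - 0)%C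
        with (psum c m [z; Cconj z; RtoC u]) by ring.
      apply H; [|exact hs|].
      * intros J hJ. destruct J as [|j [|k [|l [|]]]]; try discriminate hJ.
        destruct (Req_dec (Cmod (c [j; k; l])) 0) as [E|E].
        { left. apply Cmod_eq_0, E. }
        right. split; [reflexivity|].
        assert (c [j; k; l] <> RtoC 0).
        { intros E'. apply E. rewrite E'. apply Cmod_0. }
        apply hw in H0. simpl. lia.
      * repeat apply Forall2_cons; try apply Forall2_nil;
          rewrite ?pow_1, ?Cmod_conj, ?Cmod_R; assumption.
Qed.

(** The Taylor polynomial of weighted degree 5, with [z] of weight 1 and [w] of
    weight 2; the groups of terms are those of equal weight. *)
Definition wpoly (p : nat -> nat -> C) (z w : C) : C :=
  (p.[0, 0] + p.[1, 0] * z
   + (p.[2, 0] * z ^ 2 + p.[0, 1] * w)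
   + (p.[3, 0] * z ^ 3 + p.[1, 1] * (z * w))
   + (p.[4, 0] * z ^ 4 + p.[2, 1] * (z ^ 2 * w) + p.[0, 2] * w ^ 2)
   + (p.[5, 0] * z ^ 5 + p.[3, 1] * (z ^ 3 * w) + p.[1, 2] * (z * w ^ 2)))%C.

(** [f = wpoly p + O(6)] in the weighted sense. *)
Definition expansion (f : C -> C -> C) (p : nat -> nat -> C) : Prop :=
  exists K rho : R, 0 < rho /\
  forall (s : R) (z w : C), 0 < s < rho -> Cmod z <= s -> Cmod w <= s ^ 2 ->
    Cmod (f z w - wpoly p z w) <= K * s ^ 6.

Lemma sum_n_truncate (f : nat -> C) (n m : nat) :
  (n <= m)%nat -> (forall k, (n < k)%nat -> f k = RtoC 0) -> sum_n f m = sum_n f n.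
Proof.
  intros h Z. induction h as [|m h IH]; [reflexivity|].
  rewrite sum_Sn, IH, Z by lia. apply Cplus_0_r.
Qed.

Lemma psum_minus (c d : list nat -> C) (m : nat) (x : list C) :
  psum (fun J => c J - d J)%C m x = (psum c m x - psum d m x)%C.
Proof.
  revert c d. induction x as [|x1 x IH]; intros c d; [reflexivity|].
  change (sum_n (fun j => Cmult (Cpow x1 j) (psum (fun J => c (j :: J) - d (j :: J))%C m x)) m
   = (sum_n (fun j => Cmult (Cpow x1 j) (psum (fun J => c (j :: J)) m x)) m
      - sum_n (fun j => Cmult (Cpow x1 j) (psum (fun J => d (j :: J)) m x)) m)%C).
  generalize m at 2 4 6. intros n. induction n as [|n IHn].
  - rewrite !sum_O, IH. cring.
  - rewrite !sum_Sn, IHn, IH. cring.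
Qed.

Definition low_part (c : list nat -> C) (J : list nat) : C :=
  match J with
  | [j; k] => if Nat.leb (j + 2 * k) 5 then c J else RtoC 0
  | _ => RtoC 0
  end.

Lemma psum_low_part (c : list nat -> C) (m : nat) (z w : C) :
  (5 <= m)%nat ->
  psum (low_part c) m [z; w] = wpoly (fun j k => c [j; k]) z w.
Proof.
  intros hm.
  change (sum_n (fun j => Cmult (Cpow z j) (sum_n (fun k => Cmult (Cpow w k)
    (low_part c [j; k])) m)) m = wpoly (fun j k => c [j; k]) z w).
  assert (Z : forall j k, (5 < j + 2 * k)%nat -> low_part c [j; k] = RtoC 0).
  { intros j k h. unfold low_part. destruct (Nat.leb_spec (j + 2 * k) 5); [lia|reflexivity]. }
  transitivity (sum_n (fun j => Cmult (Cpow z j) (sum_n (fun k => Cmult (Cpow w k)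
    (low_part c [j; k])) 2)) 5).
  - rewrite (sum_n_truncate _ 5 m hm).
    + apply sum_n_ext. intros j. f_equal. apply sum_n_truncate; [lia|].
      intros k hk. rewrite Z by lia. cring.
    + intros j hj. rewrite (sum_n_truncate _ 0 m) by (try lia; intros; rewrite Z by lia; cring).
      rewrite sum_O, Z by lia. cring.
  - rewrite !sum_Sn, !sum_O. rewrite !sum_Sn, !sum_O.
    unfold wpoly. cring.
Qed.

Lemma holomorphic_expansion (f : C2 -> C) :
  holomorphic_at f origin -> exists p, expansion (fun z w => f (z, w)) p.
Proof.
  intros (c & r & hc & hf).
  destruct (psum_weighted_order [1; 2]%nat c r 6) as (K & rho & hrho & hrr & H).
  - repeat constructor.
  - exact hc.
  - exists (fun j k => c [j; k]), K, rho. split; [lra|]. intros s z w hs hz hw.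
    assert (hs2 : s ^ 2 <= s) by (simpl; rewrite <- (Rmult_1_r s) at 3; apply Rmult_le_compat_l; lra).
    apply (psum_lim_close c [z; w]).
    + replace (z, w) with (add2 origin (z, w)).
      * apply hf; lra.
      * unfold add2, origin; simpl. rewrite !Cplus_0_l. reflexivity.
    + exists 5%nat. intros m hm. rewrite <- (psum_low_part c m z w hm), <- psum_minus.
      apply H; [|exact hs|].
      * intros J hJ. destruct J as [|j [|k [|]]]; try discriminate hJ.
        unfold low_part. destruct (Nat.leb_spec (j + 2 * k) 5) as [h|h].
        { left. ring. }
        right. split; [ring|]. simpl. lia.
      * repeat apply Forall2_cons; try apply Forall2_nil; rewrite ?pow_1; assumption.
Qed.

(** * Jets along curves in the hypersurface *)

(** Coefficients in [s], up to order 5, of [wpoly p] along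
    [z = zt s], [w = om s ^ 2 + ka s ^ 5 + o(s ^ 5)]. *)
Definition composed_coefs (p : nat -> nat -> C) (zt om ka : C) : nat -> C :=
  coefs [ p.[0, 0]; p.[1, 0] * zt;
          p.[2, 0] * zt ^ 2 + p.[0, 1] * om;
          p.[3, 0] * zt ^ 3 + p.[1, 1] * (zt * om);
          p.[4, 0] * zt ^ 4 + p.[2, 1] * (zt ^ 2 * om) + p.[0, 2] * om ^ 2;
          p.[5, 0] * zt ^ 5 + p.[3, 1] * (zt ^ 3 * om)
            + p.[1, 2] * (zt * om ^ 2) + p.[0, 1] * ka ]%C.

Lemma wpoly_jet (p : nat -> nat -> C) (zt om ka : C) (w : R -> C) :
  jet 5 w (coefs [RtoC 0; RtoC 0; om; RtoC 0; RtoC 0; ka]) ->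
  jet 5 (fun s => wpoly p (RtoC s * zt) (w s))%C
    (composed_coefs p zt om ka).
Proof.
  intros W.
  assert (Z : jet 5 (fun s => RtoC s * zt)%C (coefs [RtoC 0; zt])).
  { eapply jet_ext_near; [|apply jet_taylor]. apply filter_forall. intros s.
    unfold coefs; simpl. ring. }
  assert (Z2 := jet_mult _ _ _ _ _ Z Z).
  assert (Z3 := jet_mult _ _ _ _ _ Z Z2).
  assert (Z4 := jet_mult _ _ _ _ _ Z Z3).
  assert (Z5 := jet_mult _ _ _ _ _ Z Z4).
  assert (ZW := jet_mult _ _ _ _ _ Z W).
  assert (Z2W := jet_mult _ _ _ _ _ Z ZW).
  assert (Z3W := jet_mult _ _ _ _ _ Z Z2W).
  assert (W2 := jet_mult _ _ _ _ _ W W).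
  assert (ZW2 := jet_mult _ _ _ _ _ Z W2).
  (* [S1], ..., [S5] are the groups of terms of [wpoly]. *)
  assert (S1 := jet_plus _ _ _ _ _ (jet_const 5 p.[0, 0]) (jet_scal _ p.[1, 0] _ _ Z)).
  assert (S2 := jet_plus _ _ _ _ _ (jet_scal _ p.[2, 0] _ _ Z2) (jet_scal _ p.[0, 1] _ _ W)).
  assert (S3 := jet_plus _ _ _ _ _ (jet_scal _ p.[3, 0] _ _ Z3) (jet_scal _ p.[1, 1] _ _ ZW)).
  assert (S4 := jet_plus _ _ _ _ _ (jet_plus _ _ _ _ _ (jet_scal _ p.[4, 0] _ _ Z4)
      (jet_scal _ p.[2, 1] _ _ Z2W)) (jet_scal _ p.[0, 2] _ _ W2)).
  assert (S5 := jet_plus _ _ _ _ _ (jet_plus _ _ _ _ _ (jet_scal _ p.[5, 0] _ _ Z5)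
      (jet_scal _ p.[3, 1] _ _ Z3W)) (jet_scal _ p.[1, 2] _ _ ZW2)).
  assert (T := jet_plus _ _ _ _ _ S1 (jet_plus _ _ _ _ _ S2 (jet_plus _ _ _ _ _ S3
      (jet_plus _ _ _ _ _ S4 S5)))).
  clear S1 S2 S3 S4 S5 Z2 Z3 Z4 Z5 ZW Z2W Z3W W2 ZW2.
  eapply jet_ext_near; [|eapply jet_coef_ext; [|exact T]].
  - apply filter_forall. intros s. unfold wpoly. ring.
  - unfold composed_coefs. coefwise.
Qed.

(** [M] absorbs the constants in [|z| <= M s], [|w| <= (M s) ^ 2]. *)
Lemma scaled_small (n m : nat) (h : R -> C) (K M rho : R) :
  0 < M -> 0 < rho -> (n < m)%nat ->
  at_right 0 (fun s => M * s < rho -> Cmod (h s) <= K * (M * s) ^ m) ->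
  small n h.
Proof.
  intros hM hr hn H. apply (small_bigO n (Rmax (K * M ^ m) 0)).
  assert (hd : 0 < rho / M) by (apply Rdiv_lt_0_compat; assumption).
  generalize (filter_and _ _ (at_right_lt 1 Rlt_0_1) (filter_and _ _ (at_right_lt _ hd) H)).
  apply filter_imp. intros s [h1 [h2 Hs]].
  eapply Rle_trans; [apply Hs|].
  - replace rho with (M * (rho / M)) by (field; lra). apply Rmult_lt_compat_l; lra.
  - rewrite Rpow_mult_distr, <- Rmult_assoc.
    assert (0 <= s ^ m) by (apply pow_le; lra).
    assert (s ^ m <= s ^ S n) by (apply pow_le_1_antitone; [lra|lia]).
    eapply Rle_trans; [apply Rmult_le_compat_r; [assumption|apply (Rmax_l _ 0)]|].
    apply Rmult_le_compat_l; [apply Rmax_r|assumption].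
Qed.

Lemma expansion_jet (f : C -> C -> C) (p : nat -> nat -> C) (zt om ka : C) (w : R -> C) :
  expansion f p ->
  jet 5 w (coefs [RtoC 0; RtoC 0; om; RtoC 0; RtoC 0; ka]) ->
  jet 5 (fun s => f (RtoC s * zt)%C (w s))
    (composed_coefs p zt om ka).
Proof.
  intros (K & rho & hrho & E) W.
  eapply jet_small; [|apply wpoly_jet, W].
  destruct (jet_bound 2 w _ (jet_le 5 2 _ _ ltac:(lia) W)) as (B & hB & HB).
  { intros k hk. do 2 (destruct k as [|k]; [reflexivity|]). lia. }
  assert (hz := Cmod_ge_0 zt).
  set (M := 1 + Cmod zt + B).
  apply (scaled_small 5 6 _ K M rho); [unfold M; lra|exact hrho|lia|].
  generalize (filter_and _ _ (at_right_lt 1 Rlt_0_1) HB). apply filter_imp.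
  intros s [hs Hs] hM. apply E.
  - split; [|exact hM]. apply Rmult_lt_0_compat; unfold M; lra.
  - rewrite Cmod_mult, Cmod_R, Rabs_pos_eq, Rmult_comm by lra.
    apply Rmult_le_compat_r; unfold M; lra.
  - eapply Rle_trans; [exact Hs|]. rewrite Rpow_mult_distr.
    apply Rmult_le_compat_r; [apply pow_le; lra|]. unfold M. nra.
Qed.

Definition quintic_model (F : C -> R -> R) (a : C) : Prop :=
  weighted_O6 (fun z u =>
    (RtoC (F z u) - (z * Cconj z + a * z ^ 3 * Cconj z ^ 2
                     + Cconj a * z ^ 2 * Cconj z ^ 3))%C).

(** The point of the hypersurface above [(zt s, mu s ^ 2)]. Its [w]-coordinate
    has no term in [s ^ 3] and [s ^ 4], and the coefficient [a] enters at order 5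
    only. *)
Lemma hypersurface_jet (F : C -> R -> R) (a zt : C) (mu : R) :
  quintic_model F a ->
  jet 5 (fun s => RtoC (mu * s ^ 2)%R + Ci * RtoC (F (RtoC s * zt) (mu * s ^ 2)%R))%C
    (coefs [RtoC 0; RtoC 0; RtoC mu + Ci * (zt * Cconj zt); RtoC 0; RtoC 0;
      Ci * (a * zt ^ 3 * Cconj zt ^ 2 + Cconj a * zt ^ 2 * Cconj zt ^ 3)]%C).
Proof.
  intros H. destruct (weighted_O6_estimate _ H) as (K & rho & hrho & E).
  eapply jet_small; [|apply jet_taylor].
  assert (hz := Cmod_ge_0 zt).
  assert (hm := Rabs_pos mu).
  set (M := 1 + Cmod zt + Rabs mu).
  apply (scaled_small 5 6 _ K M rho); [unfold M; lra|exact hrho|lia|].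
  generalize (at_right_lt 1 Rlt_0_1). apply filter_imp. intros s hs hM.
  specialize (E (M * s) (RtoC s * zt)%C (mu * s ^ 2)).
  eapply Rle_trans; [|apply E].
  - right. rewrite <- (Rmult_1_l (Cmod (_ - (_ + _ + _)))), <- Cmod_Ci, <- Cmod_mult.
    f_equal. rewrite !Cmult_conj.
    replace (Cconj (RtoC s)) with (RtoC s) by (apply injective_projections; simpl; lra).
    unfold coefs; simpl. rewrite !RtoC_mult. ring.
  - split; [|exact hM]. apply Rmult_lt_0_compat; unfold M; lra.
  - rewrite Cmod_mult, Cmod_R, Rabs_pos_eq, Rmult_comm by lra.
    apply Rmult_le_compat_r; unfold M; lra.
  - rewrite Rabs_mult, (Rabs_pos_eq (s ^ 2)) by (apply pow_le; lra).
    rewrite Rpow_mult_distr.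
    apply Rmult_le_compat_r; [apply pow_le; lra|]. unfold M. nra.
Qed.

(** On a hypersurface [v = z zbar + O(6)], a curve with [z = O(s)] and
    [w = O(s ^ m)] satisfies [v = z zbar + O(s ^ (3 m))]: the weighted remainder
    is of order 6 in [t ^ m], where [t = sqrt s]. The case [m = 1] is needed
    because the linear part of the second component of a normalizing map is a
    priori arbitrary. *)
Lemma normal_residual (F : C -> R -> R) (h k : R -> C) (A : R) (m : nat) :
  weighted_O6 (fun z u => (RtoC (F z u) - z * Cconj z)%C) ->
  (1 <= m <= 2)%nat -> 0 <= A ->
  at_right 0 (fun s => Cmod (h s) <= A * s ^ 1) ->
  at_right 0 (fun s => Cmod (k s) <= A * s ^ m) ->
  at_right 0 (fun s => Im (k s) = F (h s) (Re (k s))) ->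
  small (3 * m - 1) (fun s => RtoC (Im (k s)) - h s * Cconj (h s))%C.
Proof.
  intros H hm hA Hh Hk HF. destruct (weighted_O6_estimate _ H) as (K & rho & hrho & E).
  set (M := 1 + A).
  apply (small_bigO _ (K * M ^ 6)).
  assert (hd : 0 < (rho / M) ^ 2).
  { apply pow_lt. apply Rdiv_lt_0_compat; unfold M; lra. }
  generalize (filter_and _ _ (at_right_lt 1 Rlt_0_1) (filter_and _ _ (at_right_lt _ hd)
    (filter_and _ _ Hh (filter_and _ _ Hk HF)))).
  apply filter_imp. intros s [h1 [h2 [h3 [h4 h5]]]]. rewrite h5.
  set (t := sqrt s).
  assert (ht : t ^ 2 = s) by (unfold t; simpl; rewrite Rmult_1_r; apply sqrt_sqrt; lra).
  assert (ht0 : 0 < t) by (apply sqrt_lt_R0; lra).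
  assert (ht1 : t < rho / M).
  { apply Rsqr_incrst_0; [|lra|apply Rlt_le, Rdiv_lt_0_compat; unfold M; lra].
    rewrite !Rsqr_pow2, ht. lra. }
  assert (ht2 : t <= 1) by (apply Rnot_lt_le; intros h6; nra).
  assert (hMt : M * t < rho).
  { replace rho with (M * (rho / M)) by (field; unfold M; lra).
    apply Rmult_lt_compat_l; [unfold M; lra|exact ht1]. }
  assert (Hm : t ^ m * t ^ m = s ^ m) by (rewrite <- Rpow_mult_distr, <- ht; f_equal; ring).
  replace (K * M ^ 6 * s ^ S (3 * m - 1)) with (K * (M * t ^ m) ^ 6).
  2:{ replace (S (3 * m - 1)) with (3 * m)%nat by lia.
      rewrite Rpow_mult_distr, (Nat.mul_comm 3), pow_mult, <- Hm.
      rewrite Rpow_mult_distr. ring. }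
  assert (htm : 0 < t ^ m) by (apply pow_lt, ht0).
  assert (htm1 : t ^ m <= t).
  { rewrite <- (pow_1 t) at 2. apply pow_le_1_antitone; [lra|lia]. }
  assert (htm2 : s <= t ^ m).
  { rewrite <- ht. apply pow_le_1_antitone; [lra|lia]. }
  apply E.
  - split; [apply Rmult_lt_0_compat; unfold M; lra|].
    eapply Rle_lt_trans; [|exact hMt]. apply Rmult_le_compat_l; unfold M; lra.
  - eapply Rle_trans; [exact h3|]. rewrite pow_1.
    apply Rmult_le_compat; unfold M; lra.
  - eapply Rle_trans; [apply re_le_Cmod|]. eapply Rle_trans; [exact h4|].
    rewrite Rpow_mult_distr. replace ((t ^ m) ^ 2) with (s ^ m) by (rewrite <- Hm; ring).
    apply Rmult_le_compat_r; [apply pow_le; lra|]. unfold M. nra.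
Qed.

(** Hence the coefficients of [Im k] and of [h (Cconj h)] agree. *)
Lemma normal_form_jet (F : C -> R -> R) (h k : R -> C) (a b : nat -> C) (m : nat) :
  weighted_O6 (fun z u => (RtoC (F z u) - z * Cconj z)%C) ->
  (1 <= m <= 2)%nat ->
  jet 5 h a -> a O = RtoC 0 ->
  jet 5 k b -> (forall j, (j < m)%nat -> b j = RtoC 0) ->
  at_right 0 (fun s => Im (k s) = F (h s) (Re (k s))) ->
  forall j, (j <= 3 * m - 1)%nat ->
    RtoC (Im (b j)) = conv a (fun i => Cconj (a i)) j.
Proof.
  intros HF hm Hh ha Hk hb E.
  destruct (jet_bound 1 h a (jet_le 5 1 _ _ ltac:(lia) Hh)) as (A1 & hA1 & B1).
  { intros j hj. replace j with O by lia. exact ha. }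
  destruct (jet_bound m k b (jet_le 5 m _ _ ltac:(lia) Hk) hb) as (A2 & hA2 & B2).
  assert (S : small (3 * m - 1) (fun s => RtoC (Im (k s)) - h s * Cconj (h s))%C).
  { apply (normal_residual F h k (A1 + A2)); try assumption; [lra| |].
    - apply (bound_weaken 1 h A1); [lra|exact B1].
    - apply (bound_weaken m k A2); [lra|exact B2]. }
  intros j hj.
  refine (jet_unique (3 * m - 1) (fun s => RtoC (Im (k s))) (fun i => RtoC (Im (b i)))
            (conv a (fun i => Cconj (a i))) _ _ j hj).
  - apply jet_Im, (jet_le 5); [lia|exact Hk].
  - eapply jet_small; [exact S|].
    apply (jet_le 5); [lia|]. apply jet_mult; [exact Hh|]. apply jet_conj, Hh.
Qed.

Lemma locally_origin_along (P : C * C -> Prop) (h k : R -> C) (a b : nat -> C) :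
  locally (origin : C * C) P ->
  jet 5 h a -> a O = RtoC 0 -> jet 5 k b -> b O = RtoC 0 ->
  at_right 0 (fun s => P (h s, k s)).
Proof.
  intros [e He] Jh ha Jk hb.
  destruct (jet_bound 1 h a (jet_le 5 1 _ _ ltac:(lia) Jh)) as (K1 & hK1 & B1).
  { intros j hj. replace j with O by lia. exact ha. }
  destruct (jet_bound 1 k b (jet_le 5 1 _ _ ltac:(lia) Jk)) as (K2 & hK2 & B2).
  { intros j hj. replace j with O by lia. exact hb. }
  set (K := K1 + K2).
  assert (hK : 0 <= K) by (unfold K; lra).
  assert (Hh := bound_weaken 1 h K1 K ltac:(unfold K; lra) B1).
  assert (Hk := bound_weaken 1 k K2 K ltac:(unfold K; lra) B2).
  assert (hd : 0 < e / (K + 1)) by (apply Rdiv_lt_0_compat; [apply cond_pos|lra]).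
  generalize (filter_and _ _ (at_right_lt _ hd) (filter_and _ _ Hh Hk)).
  apply filter_imp. intros s [hs [h1 h2]]. rewrite pow_1 in h1, h2.
  assert (B : K * s < e).
  { assert (s * (K + 1) < e).
    { replace (pos e) with (e / (K + 1) * (K + 1)) by (field; lra).
      apply Rmult_lt_compat_r; lra. }
    lra. }
  apply He. split; simpl.
  - apply (C_NormedModule_mixin_compat1 (RtoC 0) (h s) e).
    replace (minus (h s) (RtoC 0)) with (h s); [lra|].
    unfold minus, plus, opp; simpl. cring.
  - apply (C_NormedModule_mixin_compat1 (RtoC 0) (k s) e).
    replace (minus (k s) (RtoC 0)) with (k s); [lra|].
    unfold minus, plus, opp; simpl. cring.
Qed.

Lemma expansion_zero (f : C -> C -> C) p : expansion f p -> p.[0, 0] = f (RtoC 0) (RtoC 0).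
Proof.
  intros H.
  assert (W : jet 5 (fun _ => RtoC 0) (coefs [RtoC 0; RtoC 0; RtoC 0; RtoC 0; RtoC 0; RtoC 0])).
  { eapply jet_coef_ext; [|apply jet_const]. coefwise; reflexivity. }
  assert (J := expansion_jet f p (RtoC 0) _ _ _ H W).
  assert (J2 : jet 5 (fun s => f (RtoC s * 0)%C (RtoC 0))
      (fun k => match k with O => f (RtoC 0) (RtoC 0) | _ => RtoC 0 end)).
  { eapply jet_ext_near; [|apply jet_const]. apply filter_forall.
    intros s. rewrite Cmult_0_r. reflexivity. }
  exact (jet_unique _ _ _ _ J J2 0%nat ltac:(lia)).
Qed.

(** * Independence of monomials *)

(** Monomials in [z] and its conjugate are linearly independent. The six points
    have pairwise distinct quotients [z / Cconj z], so that their values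
    determine a homogeneous polynomial of degree 5 (a Vandermonde system); lower
    degrees follow by multiplication by powers of [z]. *)
Lemma homogeneous5_zero (c0 c1 c2 c3 c4 c5 : C) :
  (forall z : C, c5 * z ^ 5 + c4 * (z ^ 4 * Cconj z) + c3 * (z ^ 3 * Cconj z ^ 2)
     + c2 * (z ^ 2 * Cconj z ^ 3) + c1 * (z * Cconj z ^ 4) + c0 * Cconj z ^ 5 = 0)%C ->
  (c5 = 0 /\ c4 = 0 /\ c3 = 0 /\ c2 = 0 /\ c1 = 0 /\ c0 = 0)%C.
Proof.
  intros H.
  generalize (H (1, 0)) (H (0, 1)) (H (1, 1)) (H (1, -1)) (H (2, 1)) (H (1, 2)).
  clear H. destruct c0, c1, c2, c3, c4, c5.
  unfold Cplus, Cmult, Cconj; simpl. unfold Cmult, RtoC; simpl.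
  intros H1 H2 H3 H4 H5 H6.
  injection H1; injection H2; injection H3; injection H4; injection H5; injection H6.
  clear. intros.
  repeat split; apply injective_projections; simpl; lra.
Qed.

Lemma quadratic_zero (a b c : C) :
  (forall t : R, a + b * RtoC t + c * RtoC t ^ 2 = 0)%C ->
  (a = 0 /\ b = 0 /\ c = 0)%C.
Proof.
  intros H. generalize (H 0) (H 1) (H (-1)). clear H. destruct a, b, c.
  unfold Cplus, Cmult, Cconj; simpl. unfold Cmult, RtoC; simpl.
  intros H1 H2 H3. injection H1; injection H2; injection H3. clear. intros.
  repeat split; apply injective_projections; simpl; lra.
Qed.

Lemma homogeneous4_zero (c0 c1 c2 c3 c4 : C) :
  (forall z : C, c4 * z ^ 4 + c3 * (z ^ 3 * Cconj z) + c2 * (z ^ 2 * Cconj z ^ 2)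
     + c1 * (z * Cconj z ^ 3) + c0 * Cconj z ^ 4 = 0)%C ->
  (c4 = 0 /\ c3 = 0 /\ c2 = 0 /\ c1 = 0 /\ c0 = 0)%C.
Proof.
  intros H. destruct (homogeneous5_zero 0 c0 c1 c2 c3 c4) as (?&?&?&?&?&_); [|tauto].
  intros z. assert (E := f_equal (Cmult z) (H z)). rewrite Cmult_0_r in E.
  eapply eq_trans; [|exact E]. ring.
Qed.

Lemma homogeneous3_zero (c0 c1 c2 c3 : C) :
  (forall z : C, c3 * z ^ 3 + c2 * (z ^ 2 * Cconj z) + c1 * (z * Cconj z ^ 2)
     + c0 * Cconj z ^ 3 = 0)%C ->
  (c3 = 0 /\ c2 = 0 /\ c1 = 0 /\ c0 = 0)%C.
Proof.
  intros H. destruct (homogeneous4_zero 0 c0 c1 c2 c3) as (?&?&?&?&_); [|tauto].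
  intros z. assert (E := f_equal (Cmult z) (H z)). rewrite Cmult_0_r in E.
  eapply eq_trans; [|exact E]. ring.
Qed.

Lemma homogeneous2_zero (c0 c1 c2 : C) :
  (forall z : C, c2 * z ^ 2 + c1 * (z * Cconj z) + c0 * Cconj z ^ 2 = 0)%C ->
  (c2 = 0 /\ c1 = 0 /\ c0 = 0)%C.
Proof.
  intros H. destruct (homogeneous3_zero 0 c0 c1 c2) as (?&?&?&_); [|tauto].
  intros z. assert (E := f_equal (Cmult z) (H z)). rewrite Cmult_0_r in E.
  eapply eq_trans; [|exact E]. ring.
Qed.

Lemma homogeneous1_zero (c0 c1 : C) :
  (forall z : C, c1 * z + c0 * Cconj z = 0)%C -> (c1 = 0 /\ c0 = 0)%C.
Proof.
  intros H. destruct (homogeneous2_zero 0 c0 c1) as (?&?&_); [|tauto].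
  intros z. assert (E := f_equal (Cmult z) (H z)). rewrite Cmult_0_r in E.
  eapply eq_trans; [|exact E]. ring.
Qed.

(** * Relations between the Taylor coefficients of a normalizing map *)

Lemma Ci2 : (Ci ^ 2 = - (1))%C.
Proof. apply injective_projections; simpl; ring. Qed.

Lemma Cconj_Ci : Cconj Ci = (- Ci)%C.
Proof. apply injective_projections; simpl; ring. Qed.

Lemma Cconj_R (r : R) : Cconj (RtoC r) = RtoC r.
Proof. apply injective_projections; simpl; ring. Qed.

Lemma two_i_Im (x y : C) : RtoC (Im x) = y -> (x - Cconj x - 2 * Ci * y = 0)%C.
Proof. intros <-. rewrite im_alt'. ring. Qed.

Ltac pushc :=
  repeat rewrite ?Cplus_conj, ?Cminus_conj, ?Cmult_conj, ?Copp_conj, ?Cpow_conj,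
    ?Cconj_conj, ?Cconj_Ci, ?Cconj_R.

(** The equation [Im g = |f| ^ 2] of the image hypersurface, at order [j] in [s],
    along the points of the source hypersurface above [(z s, t s ^ 2)]; [p] and
    [q] are the coefficients of [f] and [g]. *)
Definition normal_relation (p q : nat -> nat -> C) (a : C) (j : nat) : Prop :=
  forall (z : C) (t : R),
    let om := (RtoC t + Ci * (z * Cconj z))%C in
    let ka := (Ci * (a * z ^ 3 * Cconj z ^ 2 + Cconj a * z ^ 2 * Cconj z ^ 3))%C in
    RtoC (Im (composed_coefs q z om ka j))
    = conv (composed_coefs p z om ka) (fun i => Cconj (composed_coefs p z om ka i)) j.

(** The curves [s |-> (z s, t s ^ 2 + i F)] lie in [N], so their images lie in
    [N'], whose equation gives relations between Taylor coefficients. *)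
Lemma normal_image_relations (N N' : C2 -> Prop) (F : C -> R -> R) (a : C)
    (Phi : C2 -> C2) (p q : nat -> nat -> C) :
  graphed_at_origin N F -> quintic_model F a -> normal_at_origin N' ->
  locally (origin : C * C) (fun P : C * C => N P <-> N' (Phi P)) ->
  Phi origin = origin ->
  expansion (fun z w => fst (Phi (z, w))) p ->
  expansion (fun z w => snd (Phi (z, w))) q ->
  forall j, (2 <= j <= 5)%nat -> normal_relation p q a j.
Proof.
  intros hN hF (F' & hN' & hF') hNN h0 Ep Eq.
  assert (p00 := expansion_zero _ _ Ep). assert (q00 := expansion_zero _ _ Eq).
  change (p.[0, 0] = fst (Phi origin)) in p00.
  change (q.[0, 0] = snd (Phi origin)) in q00.
  rewrite h0 in p00, q00. simpl in p00, q00.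
  assert (X : forall (z : C) (t : R),
    let om := (RtoC t + Ci * (z * Cconj z))%C in
    let ka := (Ci * (a * z ^ 3 * Cconj z ^ 2 + Cconj a * z ^ 2 * Cconj z ^ 3))%C in
    exists h k : R -> C,
      jet 5 h (composed_coefs p z om ka) /\ jet 5 k (composed_coefs q z om ka) /\
      at_right 0 (fun s => Im (k s) = F' (h s) (Re (k s)))).
  { intros z t om ka.
    assert (W := hypersurface_jet F a z t hF). fold om ka in W.
    set (w := fun s : R => (RtoC (t * s ^ 2)%R
        + Ci * RtoC (F (RtoC s * z) (t * s ^ 2)%R))%C) in W.
    assert (Jh := expansion_jet _ _ z _ _ _ Ep W).
    assert (Jk := expansion_jet _ _ z _ _ _ Eq W).
    exists (fun s => fst (Phi ((RtoC s * z)%C, w s))), (fun s => snd (Phi ((RtoC s * z)%C, w s))).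
    split; [exact Jh|]. split; [exact Jk|].
    assert (Jz : jet 5 (fun s => RtoC s * z)%C (coefs [RtoC 0; z])).
    { eapply jet_ext_near; [|apply jet_taylor]. apply filter_forall. intros s.
      unfold coefs; simpl. ring. }
    generalize (filter_and _ _ (locally_origin_along _ _ _ _ _ hN Jz eq_refl W eq_refl)
      (filter_and _ _ (locally_origin_along _ _ _ _ _ hNN Jz eq_refl W eq_refl)
         (locally_origin_along _ _ _ _ _ hN' Jh p00 Jk q00))).
    apply filter_imp. intros s [A1 [A2 A3]].
    rewrite <- surjective_pairing in A3. apply A3. apply A2. apply A1.
    unfold w; simpl. unfold Im, Re; simpl. rewrite ?Rmult_0_l, ?Rmult_0_r, ?Rmult_1_l,
      ?Rplus_0_l, ?Rminus_0_r, ?Rplus_0_r. reflexivity. }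
  (* At order 1, [Im (q10 z) = 0] for every [z]; only once [q10 = 0] is known is
     the second component [O(s ^ 2)] along the curve. *)
  assert (q10 : q.[1, 0] = RtoC 0).
  { assert (I1 : forall z, Im (q.[1, 0] * z) = 0).
    { intros z. destruct (X z 0) as (h & k & Jh & Jk & E). apply RtoC_inj.
      refine (eq_trans (normal_form_jet F' h k _ _ 1 hF' ltac:(lia) Jh p00 Jk _ E 1%nat ltac:(lia)) _).
      - intros j hj. replace j with O by lia. exact q00.
      - unfold composed_coefs, coefs. cbn [conv nth]. rewrite p00. pushc. ring. }
    generalize (I1 (RtoC 1)) (I1 Ci). destruct q.[1, 0]. unfold Im; simpl.
    intros. apply injective_projections; simpl; lra. }
  intros j hj z t om ka. destruct (X z t) as (h & k & Jh & Jk & E). fold om ka in Jh, Jk.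
  refine (normal_form_jet F' h k _ _ 2 hF' ltac:(lia) Jh p00 Jk _ E j ltac:(lia)).
  intros i hi. destruct i as [|[|i]]; [exact q00| |lia].
  unfold composed_coefs, coefs. cbn [nth]. rewrite q10. ring.
Qed.

Local Open Scope C_scope.

(* Identifies the polynomial in [t] of the goal with the relation [H]. *)
Ltac expand p00 H z t :=
  intros t; eapply eq_trans; [|exact (two_i_Im _ _ (H z t))];
  unfold composed_coefs, coefs; cbn [nth conv]; rewrite ?p00; pushc; ring [Ci2].

(** In each of the next four lemmas, [Q] lists the coefficients of the relation:
    first by powers of [t], then by monomials in [z] and [Cconj z]. Conjugate
    monomials have coefficients that are opposite up to conjugation, so that half
    of the equations are redundant. *)
Lemma weight2_relation (p q : nat -> nat -> C) (a : C) :
  p.[0, 0] = RtoC 0 -> normal_relation p q a 2 ->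
  q.[0, 1] = p.[1, 0] * Cconj p.[1, 0].
Proof.
  intros p00 H.
  assert (Q : forall z : C,
    q.[2, 0] * z ^ 2 + (Ci * (q.[0, 1] + Cconj q.[0, 1])
        - 2 * Ci * p.[1, 0] * Cconj p.[1, 0]) * (z * Cconj z)
      + (- Cconj q.[2, 0]) * Cconj z ^ 2 = 0 /\ q.[0, 1] - Cconj q.[0, 1] = 0 /\ RtoC 0 = 0).
  { intros z. apply quadratic_zero. expand p00 H z t. }
  destruct (homogeneous2_zero _ _ _ (fun z => proj1 (Q z))) as (_ & E1 & _).
  destruct (Q 0) as (_ & E2 & _).
  assert (E3 : 2 * Ci * q.[0, 1] = 2 * Ci * (p.[1, 0] * Cconj p.[1, 0])).
  { transitivity (Ci * (q.[0, 1] + Cconj q.[0, 1]) + Ci * (q.[0, 1] - Cconj q.[0, 1])); [ring|].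
    rewrite E2. transitivity (Ci * (q.[0, 1] + Cconj q.[0, 1])
        - 2 * Ci * p.[1, 0] * Cconj p.[1, 0] + 2 * Ci * (p.[1, 0] * Cconj p.[1, 0])); [ring|].
    rewrite E1. ring. }
  replace q.[0, 1] with (2 * Ci * q.[0, 1] / (2 * Ci)) by (field; exact Ci_nz).
  rewrite E3. field. exact Ci_nz.
Qed.

Lemma weight3_relation (p q : nat -> nat -> C) (a : C) :
  p.[0, 0] = RtoC 0 -> normal_relation p q a 3 ->
  p.[2, 0] * Cconj p.[1, 0] = 2 * Ci * p.[1, 0] * Cconj p.[0, 1].
Proof.
  intros p00 H.
  assert (Q : forall z : C,
    q.[3, 0] * z ^ 3 + (Ci * q.[1, 1] - 2 * p.[1, 0] * Cconj p.[0, 1]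
        - 2 * Ci * p.[2, 0] * Cconj p.[1, 0]) * (z ^ 2 * Cconj z)
    + (Ci * Cconj q.[1, 1] - 2 * Ci * p.[1, 0] * Cconj p.[2, 0]
        + 2 * p.[0, 1] * Cconj p.[1, 0]) * (z * Cconj z ^ 2)
        + (- Cconj q.[3, 0]) * Cconj z ^ 3 = 0
    /\ (q.[1, 1] - 2 * Ci * p.[1, 0] * Cconj p.[0, 1]) * z + (- Cconj q.[1, 1]
        - 2 * Ci * p.[0, 1] * Cconj p.[1, 0]) * Cconj z = 0 /\ RtoC 0 = 0).
  { intros z. apply quadratic_zero. expand p00 H z t. }
  destruct (homogeneous3_zero _ _ _ _ (fun z => proj1 (Q z))) as (_ & E1 & _).
  destruct (homogeneous1_zero _ _ (fun z => proj1 (proj2 (Q z)))) as (E2 & _).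
  apply Ceq_minus in E2. rewrite E2 in E1.
  apply Ceq_minus.
  transitivity ((Ci / 2) * (Ci * (2 * Ci * p.[1, 0] * Cconj p.[0, 1])
      - 2 * p.[1, 0] * Cconj p.[0, 1] - 2 * Ci * p.[2, 0] * Cconj p.[1, 0])).
  - field [Ci2].
  - rewrite E1. ring.
Qed.

Lemma weight4_relation (p q : nat -> nat -> C) (a : C) :
  p.[0, 0] = RtoC 0 -> normal_relation p q a 4 ->
  q.[0, 2] + Cconj q.[0, 2] = p.[1, 0] * Cconj p.[1, 1] + p.[1, 1] * Cconj p.[1, 0]
  /\ p.[3, 0] * Cconj p.[1, 0] = 2 * Ci * p.[2, 0] * Cconj p.[0, 1]
  /\ p.[1, 1] * Cconj p.[1, 0] - p.[1, 0] * Cconj p.[1, 1] = Ci * (p.[2, 0] * Cconj p.[2, 0]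
      + 2 * p.[0, 1] * Cconj p.[0, 1]).
Proof.
  intros p00 H.
  assert (Q : forall z : C,
    q.[4, 0] * z ^ 4 + (Ci * q.[2, 1] - 2 * Ci * p.[3, 0] * Cconj p.[1, 0]
        - 2 * p.[2, 0] * Cconj p.[0, 1]) * (z ^ 3 * Cconj z)
    + (- q.[0, 2] + Cconj q.[0, 2] - 2 * Ci * (- Ci * p.[1, 0] * Cconj p.[1, 1]
        + Ci * p.[1, 1] * Cconj p.[1, 0] + p.[2, 0] * Cconj p.[2, 0]
        + p.[0, 1] * Cconj p.[0, 1])) * (z ^ 2 * Cconj z ^ 2)
    + (Ci * Cconj q.[2, 1] - 2 * Ci * p.[1, 0] * Cconj p.[3, 0]
        + 2 * p.[0, 1] * Cconj p.[2, 0]) * (z * Cconj z ^ 3)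
        + (- Cconj q.[4, 0]) * Cconj z ^ 4 = 0
    /\ (q.[2, 1] - 2 * Ci * p.[2, 0] * Cconj p.[0, 1]) * z ^ 2
       + (2 * Ci * (q.[0, 2] + Cconj q.[0, 2]) - 2 * Ci * (p.[1, 0] * Cconj p.[1, 1]
           + p.[1, 1] * Cconj p.[1, 0])) * (z * Cconj z)
       + (- Cconj q.[2, 1] - 2 * Ci * p.[0, 1] * Cconj p.[2, 0]) * Cconj z ^ 2 = 0
    /\ q.[0, 2] - Cconj q.[0, 2] - 2 * Ci * p.[0, 1] * Cconj p.[0, 1] = 0).
  { intros z. apply quadratic_zero. expand p00 H z t. }
  destruct (homogeneous4_zero _ _ _ _ _ (fun z => proj1 (Q z))) as (_ & E1 & E2 & _).
  destruct (homogeneous2_zero _ _ _ (fun z => proj1 (proj2 (Q z)))) as (E3 & E4 & _).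
  destruct (Q 0) as (_ & _ & E5). clear Q.
  apply Ceq_minus in E5. apply Ceq_minus in E3. rewrite E3 in E1.
  repeat split; apply Ceq_minus.
  - transitivity ((2 * Ci * (q.[0, 2] + Cconj q.[0, 2]) - 2 * Ci * (p.[1, 0] * Cconj p.[1, 1]
      + p.[1, 1] * Cconj p.[1, 0])) / (2 * Ci)).
    + field. exact Ci_nz.
    + rewrite E4. field. exact Ci_nz.
  - transitivity ((Ci / 2) * (Ci * (2 * Ci * p.[2, 0] * Cconj p.[0, 1])
      - 2 * Ci * p.[3, 0] * Cconj p.[1, 0] - 2 * p.[2, 0] * Cconj p.[0, 1])).
    + field [Ci2].
    + rewrite E1. ring.
  - transitivity ((- q.[0, 2] + Cconj q.[0, 2] - 2 * Ci * (- Ci * p.[1, 0] * Cconj p.[1, 1]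
      + Ci * p.[1, 1] * Cconj p.[1, 0] + p.[2, 0] * Cconj p.[2, 0] + p.[0, 1] * Cconj p.[0, 1])
        + (q.[0, 2] - Cconj q.[0, 2] - 2 * Ci * p.[0, 1] * Cconj p.[0, 1])) / 2).
    + field [Ci2].
    + rewrite E2, E5. field.
Qed.

(** The unknowns [q.[1, 2]] and [p.[2, 1]] are eliminated between the
    coefficients of [z ^ 3 zbar ^ 2], [z ^ 2 zbar t] and [z t ^ 2]. *)
Lemma weight5_relation (p q : nat -> nat -> C) (a : C) :
  p.[0, 0] = RtoC 0 -> normal_relation p q a 5 ->
  (q.[0, 1] + Cconj q.[0, 1]) * a = 2 * (- (4) * p.[1, 0] * Cconj p.[0, 2]
      - 2 * Ci * p.[2, 0] * Cconj p.[1, 1] + p.[3, 0] * Cconj p.[2, 0]).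
Proof.
  intros p00 H.
  assert (Q : forall z : C,
    q.[5, 0] * z ^ 5 + (Ci * q.[3, 1] - 2 * Ci * (p.[4, 0] * Cconj p.[1, 0]
        - Ci * p.[3, 0] * Cconj p.[0, 1])) * (z ^ 4 * Cconj z)
    + (- q.[1, 2] + Ci * (q.[0, 1] + Cconj q.[0, 1]) * a
        - 2 * Ci * (- p.[1, 0] * Cconj p.[0, 2] + Ci * p.[2, 1] * Cconj p.[1, 0]
        + p.[1, 1] * Cconj p.[0, 1]
          + p.[3, 0] * Cconj p.[2, 0] - Ci * p.[2, 0] * Cconj p.[1, 1])) * (z ^ 3 * Cconj z ^ 2)
    + (Cconj q.[1, 2] + Ci * (q.[0, 1] + Cconj q.[0, 1]) * Cconj a
        - 2 * Ci * (- Cconj p.[1, 0] * p.[0, 2] - Ci * Cconj p.[2, 1] * p.[1, 0]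
        + Cconj p.[1, 1] * p.[0, 1]
          + Cconj p.[3, 0] * p.[2, 0] + Ci * Cconj p.[2, 0] * p.[1, 1])) * (z ^ 2 * Cconj z ^ 3)
    + (Ci * Cconj q.[3, 1] - 2 * Ci * (Cconj p.[4, 0] * p.[1, 0]
        + Ci * Cconj p.[3, 0] * p.[0, 1])) * (z * Cconj z ^ 4)
    + (- Cconj q.[5, 0]) * Cconj z ^ 5 = 0
    /\ (q.[3, 1] - 2 * Ci * p.[3, 0] * Cconj p.[0, 1]) * z ^ 3
       + (2 * Ci * q.[1, 2] - 2 * Ci * (- 2 * Ci * p.[1, 0] * Cconj p.[0, 2]
           + p.[2, 1] * Cconj p.[1, 0] + p.[2, 0] * Cconj p.[1, 1])) * (z ^ 2 * Cconj z)
       + (2 * Ci * Cconj q.[1, 2] - 2 * Ci * (2 * Ci * Cconj p.[1, 0] * p.[0, 2]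
           + Cconj p.[2, 1] * p.[1, 0] + Cconj p.[2, 0] * p.[1, 1])) * (z * Cconj z ^ 2)
       + (- Cconj q.[3, 1] - 2 * Ci * Cconj p.[3, 0] * p.[0, 1]) * Cconj z ^ 3 = 0
    /\ (q.[1, 2] - 2 * Ci * (p.[1, 0] * Cconj p.[0, 2] + p.[1, 1] * Cconj p.[0, 1])) * z
       + (- Cconj q.[1, 2] - 2 * Ci * (Cconj p.[1, 0] * p.[0, 2]
           + Cconj p.[1, 1] * p.[0, 1])) * Cconj z = 0).
  { intros z. apply quadratic_zero. expand p00 H z t. }
  destruct (homogeneous5_zero _ _ _ _ _ _ (fun z => proj1 (Q z))) as (_ & _ & E1 & _).
  destruct (homogeneous3_zero _ _ _ _ (fun z => proj1 (proj2 (Q z)))) as (_ & E2 & _).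
  destruct (homogeneous1_zero _ _ (fun z => proj2 (proj2 (Q z)))) as (E3 & _). clear Q.
  apply Ceq_minus.
  transitivity (- Ci * (- q.[1, 2] + Ci * (q.[0, 1] + Cconj q.[0, 1]) * a
      - 2 * Ci * (- p.[1, 0] * Cconj p.[0, 2] + Ci * p.[2, 1] * Cconj p.[1, 0]
      + p.[1, 1] * Cconj p.[0, 1]
          + p.[3, 0] * Cconj p.[2, 0] - Ci * p.[2, 0] * Cconj p.[1, 1]))
     - (2 * Ci * q.[1, 2] - 2 * Ci * (- 2 * Ci * p.[1, 0] * Cconj p.[0, 2]
         + p.[2, 1] * Cconj p.[1, 0] + p.[2, 0] * Cconj p.[1, 1]))
     + Ci * (q.[1, 2] - 2 * Ci * (p.[1, 0] * Cconj p.[0, 2] + p.[1, 1] * Cconj p.[0, 1]))).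
  - ring [Ci2].
  - rewrite E1, E2, E3. ring.
Qed.

Local Close Scope C_scope.

(** * The 2-jet of the image of the axis *)

Lemma taylor_young1 (f : R -> R) (f1 e : R) :
  is_derive f 0 f1 -> 0 < e ->
  locally 0 (fun s => Rabs (f s - f 0 - f1 * s) <= e * Rabs s).
Proof.
  intros [_ H] he.
  specialize (H 0 (fun P Q => Q) (mkposreal e he)).
  revert H. apply filter_imp. intros s H. simpl in H.
  unfold minus, plus, opp, scal, norm in H; simpl in H. unfold mult, abs in H; simpl in H.
  replace (f s - f 0 - f1 * s) with (f s + - f 0 + - ((s + - 0) * f1)) by ring.
  replace s with (s + - 0) at 3 by ring. exact H.
Qed.

(** Peano's form of the remainder, which assumes no more than the existence of
    the second derivative at the point. *)
Lemma taylor_young2 (f : R -> R) (f1 f2 e : R) :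
  derivatives2 f 0 f1 f2 -> 0 < e ->
  locally 0 (fun s => Rabs (f s - f 0 - f1 * s - f2 / 2 * s ^ 2) <= e * s ^ 2).
Proof.
  intros (D & D1 & D2) he.
  assert (E1 : Derive f 0 = f1) by (apply is_derive_unique; exact D1).
  destruct (filter_and _ _ D (taylor_young1 _ _ e D2 he)) as [d Hd].
  exists d. intros s hs.
  assert (B : forall x, Rabs x <= Rabs s -> ball 0 d x).
  { intros x hx. unfold ball in *; simpl in *.
    unfold AbsRing_ball, abs, minus, plus, opp in *; simpl in *.
    replace (x + - 0) with x by ring. replace (s + - 0) with s in hs by ring. lra. }
  set (k := fun x => f x - f 0 - f1 * x - f2 / 2 * x ^ 2).
  assert (Dk : forall x, Rabs x <= Rabs s -> is_derive k x (Derive f x - f1 - f2 * x)).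
  { intros x hx. destruct (Hd x (B x hx)) as [Hx _]. unfold k.
    auto_derive; [exact Hx|]. change (Derive (fun x0 => f x0) x) with (Derive f x). field. }
  destruct (MVT_gen k 0 s (fun x => Derive f x - f1 - f2 * x)) as [c [hc Hc]].
  - intros x hx. apply Dk.
    unfold Rmin, Rmax in hx. destruct (Rle_dec 0 s); unfold Rabs;
      destruct (Rcase_abs x), (Rcase_abs s); lra.
  - intros x hx. apply derivable_continuous_pt.
    exists (Derive f x - f1 - f2 * x). apply is_derive_Reals, Dk.
    unfold Rmin, Rmax in hx. destruct (Rle_dec 0 s); unfold Rabs;
      destruct (Rcase_abs x), (Rcase_abs s); lra.
  - assert (hcs : Rabs c <= Rabs s).
    { unfold Rmin, Rmax in hc. destruct (Rle_dec 0 s); unfold Rabs;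
        destruct (Rcase_abs c), (Rcase_abs s); lra. }
    destruct (Hd c (B c hcs)) as [_ Hc2]. rewrite E1 in Hc2.
    assert (K0 : k 0 = 0) by (unfold k; simpl; field).
    change (Rabs (k s) <= e * s ^ 2).
    replace (k s) with ((Derive f c - f1 - f2 * c) * (s - 0)) by (rewrite <- Hc, K0; ring).
    rewrite Rabs_mult, Rminus_0_r.
    replace (e * s ^ 2) with (e * Rabs s * Rabs s) by (rewrite <- (pow2_abs s); ring).
    apply Rmult_le_compat_r; [apply Rabs_pos|].
    eapply Rle_trans; [exact Hc2|]. apply Rmult_le_compat_l; lra.
Qed.

Lemma at_right_locally (P : R -> Prop) : locally 0 P -> at_right 0 P.
Proof. apply (filter_imp (F := locally 0) P). intros s H _. exact H. Qed.

Lemma is_derive_jet (f : R -> R) (d : R) :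
  is_derive f 0 d -> jet 1 (fun s => RtoC (f s)) (coefs [RtoC (f 0); RtoC d]).
Proof.
  intros H e he.
  generalize (filter_and _ _ (at_right_lt 1 Rlt_0_1) (at_right_locally _ (taylor_young1 f d e H he))).
  apply filter_imp. intros s [hs Hs]. rewrite (Rabs_pos_eq s) in Hs by lra.
  unfold coefs; simpl. rewrite Rmult_1_r.
  rewrite <- RtoC_mult, <- RtoC_plus, <- RtoC_minus, Cmod_R.
  replace (f s - (f 0 + s * d)) with (f s - f 0 - d * s) by ring. exact Hs.
Qed.

Lemma derivatives2_along (x U : R -> R) (x1 x2 A : R) :
  derivatives2 x 0 x1 x2 -> 0 <= A ->
  at_right 0 (fun s => Rabs (U s) <= A * s) ->
  small 2 (fun s => RtoC (x (U s) - x 0 - x1 * U s - x2 / 2 * U s ^ 2)).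
Proof.
  intros H hA HU e he.
  assert (he' : 0 < e / (A + 1) ^ 2) by (apply Rdiv_lt_0_compat; [|apply pow_lt]; lra).
  destruct (taylor_young2 x x1 x2 _ H he') as [d Hd].
  assert (hd : 0 < d / (A + 1)) by (apply Rdiv_lt_0_compat; [apply cond_pos|lra]).
  generalize (filter_and _ _ (at_right_lt _ hd) HU). apply filter_imp.
  intros s [hs Hs]. rewrite Cmod_R.
  assert (hUs : Rabs (U s) <= (A + 1) * s) by lra.
  eapply Rle_trans; [apply Hd|].
  - unfold ball; simpl. unfold AbsRing_ball, abs, minus, plus, opp; simpl.
    replace (U s + - 0) with (U s) by ring.
    eapply Rle_lt_trans; [exact hUs|].
    replace (pos d) with ((A + 1) * (d / (A + 1))) by (field; lra).
    apply Rmult_lt_compat_l; lra.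
  - replace (e * s ^ 2) with (e / (A + 1) ^ 2 * ((A + 1) * s) ^ 2) by (field; lra).
    apply Rmult_le_compat_l; [lra|]. rewrite <- pow2_abs.
    apply pow_incr. split; [apply Rabs_pos|exact hUs].
Qed.

(** On [z = 0] the weighted bound is applied with [sqrt s], as [w = s] has
    weight 2. *)
Lemma expansion_axis_jet (f : C -> C -> C) (p : nat -> nat -> C) :
  expansion f p ->
  jet 2 (fun s => f (RtoC 0) (RtoC s))
    (coefs [p.[0, 0]; p.[0, 1]; p.[0, 2]]).
Proof.
  intros (K & rho & hrho & E).
  eapply jet_small; [|apply jet_taylor].
  apply (small_bigO _ K).
  assert (hd : 0 < rho ^ 2) by (apply pow_lt, hrho).
  generalize (at_right_lt _ hd). apply filter_imp. intros s hs.
  assert (ht : sqrt s ^ 2 = s) by (simpl; rewrite Rmult_1_r; apply sqrt_sqrt; lra).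
  specialize (E (sqrt s) (RtoC 0) (RtoC s)).
  replace (s ^ 3) with (sqrt s ^ 6) by (rewrite <- ht at 2; ring).
  eapply Rle_trans; [|apply E].
  - right. f_equal. unfold coefs, wpoly; simpl. ring.
  - split; [apply sqrt_lt_R0; lra|].
    apply Rsqr_incrst_0; [|apply sqrt_pos|lra]. rewrite !Rsqr_pow2, ht. lra.
  - rewrite Cmod_0. apply sqrt_pos.
  - rewrite Cmod_R, Rabs_pos_eq, ht; lra.
Qed.

(** If the curve is the graph of [x + i y] over [U = Re (snd sigma)], then
    [fst sigma = (x1 + i y1) U + (x2 + i y2) U ^ 2 / 2 + o(U ^ 2)]; the relations
    express the coefficients of both sides. *)
Lemma axis_jet_relations (sigma : R -> C2) (a b : nat -> C) (x1 y1 x2 y2 : R) :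
  jet 2 (fun s => fst (sigma s)) a -> jet 2 (fun s => snd (sigma s)) b ->
  sigma 0 = origin -> b O = RtoC 0 ->
  graph_jet sigma 0 x1 y1 x2 y2 ->
  Re (b 1%nat) <> 0 /\
  a 1%nat = ((x1, y1) * RtoC (Re (b 1%nat)))%C /\
  a 2%nat = ((x1, y1) * RtoC (Re (b 2%nat))
             + (x2 / 2, y2 / 2)%R * RtoC (Re (b 1%nat)) ^ 2)%C.
Proof.
  intros Ha Hb H0 Hb0 [[d [Hd hd]] [x [y [Hxy [Dx Dy]]]]].
  set (U := fun s => Re (snd (sigma s))) in *.
  assert (U0 : U 0 = 0) by (unfold U; rewrite H0; reflexivity).
  assert (JU := jet_Re 2 _ _ Hb). change (jet 2 (fun s => RtoC (U s))
      (fun j => RtoC (Re (b j)))) in JU.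
  assert (E1 : Re (b 1%nat) = d).
  { apply RtoC_inj. refine (jet_unique 1 (fun s => RtoC (U s)) (fun j => RtoC (Re (b j)))
      (coefs [RtoC (U 0); RtoC d]) _ _ 1%nat _).
    - exact (jet_le 2 1 _ (fun j => RtoC (Re (b j))) ltac:(lia) JU).
    - apply is_derive_jet, Hd.
    - lia. }
  split; [rewrite E1; exact hd|].
  assert (Hxy0 := locally_singleton _ _ Hxy). simpl in Hxy0. fold (U 0) in Hxy0.
  rewrite U0, H0 in Hxy0. unfold origin in Hxy0. simpl in Hxy0.
  injection Hxy0. intros hy0 hx0. clear Hxy0.
  destruct (jet_bound 1 _ _ (jet_le 2 1 _ _ ltac:(lia) JU)) as (A & hA & HA).
  { intros k hk. replace k with O by lia. rewrite Hb0. reflexivity. }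
  assert (HA' : at_right 0 (fun s => Rabs (U s) <= A * s)).
  { revert HA. apply filter_imp. intros s. rewrite Cmod_R, pow_1. trivial. }
  assert (Sx := derivatives2_along x U x1 x2 A Dx hA HA').
  assert (Sy := small_scal _ Ci _ (derivatives2_along y U y1 y2 A Dy hA HA')).
  assert (S := small_plus _ _ _ Sx Sy).
  assert (T := jet_plus _ _ _ _ _ (jet_scal _ (x1, y1) _ _ JU)
                 (jet_scal _ (x2 / 2, y2 / 2) _ _ (jet_mult _ _ _ _ _ JU JU))).
  assert (J : jet 2 (fun s => fst (sigma s))
     (fun m => (x1, y1) * RtoC (Re (b m)) + (x2 / 2, y2 / 2)%R *
        conv (fun j => RtoC (Re (b j))) (fun j => RtoC (Re (b j))) m)%C).
  { eapply jet_small; [|exact T]. eapply small_ext_near; [|exact S].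
    generalize (at_right_locally _ Hxy). apply filter_imp. intros s Hs.
    fold (U s) in Hs. change (fst (sigma s) = (x (U s), y (U s))) in Hs. rewrite Hs.
    rewrite <- hx0, <- hy0. apply injective_projections; simpl; field. }
  split.
  - rewrite (jet_unique _ _ _ _ Ha J 1%nat) by lia. simpl. rewrite Hb0.
    simpl Re. change (Re (RtoC 0)) with 0. ring.
  - rewrite (jet_unique _ _ _ _ Ha J 2%nat) by lia. simpl. rewrite Hb0.
    change (Re (RtoC 0)) with 0. ring.
Qed.

(** * Vanishing of the coefficient *)

Lemma Cmult_cancel_r (x y c : C) : c <> RtoC 0 -> (x * c = y * c)%C -> x = y.
Proof.
  intros hc E. transitivity (x * c / c)%C; [field; exact hc|].
  rewrite E. field. exact hc.
Qed.

(** Write [l = p.[1, 0]], [L = Cconj l], [Z = x1 + i y1] and [g = Re q.[0, 2]].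
    Then [q.[0, 1] = l L] and [p.[0, 1] = Z l L], and the relations of orders 3
    and 4 give [p.[2, 0]], [p.[3, 0]] and [p.[1, 1]] in terms of [l], [Z] and [g].
    On [Sigma0], that is for [x2 + i y2 = 2 i Z ^ 2 (Cconj Z)], the formula for
    [p.[0, 2]] reads [p.[0, 2] = Z g + i Z ^ 2 (Cconj Z) (l L) ^ 2]. The
    right-hand side in [weight5_relation] then cancels: the terms in [g] are opposite, and
    those in [l ^ 3 L ^ 2 Z (Cconj Z) ^ 2] are [4 i - 12 i + 8 i = 0]. *)
Lemma coefficient_vanishes (p q : nat -> nat -> C) (a : C) (x1 y1 x2 y2 : R) :
  p.[0, 0] = RtoC 0 ->
  (forall j, (2 <= j <= 5)%nat -> normal_relation p q a j) ->
  Re q.[0, 1] <> 0 ->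
  p.[0, 1] = ((x1, y1) * RtoC (Re q.[0, 1]))%C ->
  p.[0, 2] = ((x1, y1) * RtoC (Re q.[0, 2])
             + (x2 / 2, y2 / 2)%R * RtoC (Re q.[0, 1]) ^ 2)%C ->
  Sigma0 x1 y1 x2 y2 ->
  a = RtoC 0.
Proof.
  intros p00 H hq E01 E02 [S1 S2].
  assert (R2 := weight2_relation p q a p00 (H 2%nat ltac:(lia))).
  assert (R3 := weight3_relation p q a p00 (H 3%nat ltac:(lia))).
  destruct (weight4_relation p q a p00 (H 4%nat ltac:(lia))) as (R4a & R4b & R4c).
  assert (R5 := weight5_relation p q a p00 (H 5%nat ltac:(lia))).
  clear H p00.
  assert (hb : RtoC (Re q.[0, 1]) = q.[0, 1]).
  { rewrite RtoC_Re, R2. pushc. rewrite RtoC_inv by lra. field. }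
  assert (hq' : q.[0, 1] <> RtoC 0).
  { rewrite <- hb. intros E. apply RtoC_inj in E. contradiction. }
  rewrite hb in E01, E02. clear hb hq.
  set (g := RtoC (Re q.[0, 2])) in *.
  assert (hg : Cconj g = g) by apply Cconj_R.
  assert (hg2 : (2 * g = p.[1, 0] * Cconj p.[1, 1]
                         + p.[1, 1] * Cconj p.[1, 0])%C).
  { rewrite <- R4a. unfold g. rewrite RtoC_Re, RtoC_inv by lra. field. }
  clear R4a. clearbody g.
  assert (EZ : ((x2 / 2, y2 / 2)%R : C) = (Ci * (x1, y1) ^ 2 * Cconj (x1, y1))%C).
  { rewrite S1, S2. apply injective_projections; simpl; field. }
  rewrite EZ in E02. clear S1 S2 EZ.
  set (Z := ((x1, y1) : C)) in *. clearbody Z.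
  rewrite R2 in *.
  set (l := p.[1, 0]) in *.
  assert (hL : Cconj l <> RtoC 0) by (intros E; apply hq'; rewrite E; ring).
  assert (P20 : p.[2, 0] = (2 * Ci * l ^ 2 * Cconj Z)%C).
  { apply (Cmult_cancel_r _ _ (Cconj l) hL). rewrite R3, E01. pushc. ring. }
  assert (P30 : p.[3, 0] = (- (4) * l ^ 3 * Cconj Z ^ 2)%C).
  { apply (Cmult_cancel_r _ _ (Cconj l) hL). rewrite R4b, P20, E01. pushc. ring [Ci2]. }
  assert (P11 : (l * Cconj p.[1, 1] = g - 3 * Ci * l ^ 2 * Cconj l ^ 2 * Z * Cconj Z)%C).
  { rewrite P20, E01 in R4c.
    apply (Cmult_cancel_r _ _ (RtoC 2)); [apply RtoC_neq0; lra|].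
    transitivity (2 * g - (p.[1, 1] * Cconj l - l * Cconj p.[1, 1]))%C.
    - rewrite hg2. ring.
    - rewrite R4c. pushc. ring [Ci2]. }
  apply (Cmult_cancel_r _ _ (2 * (l * Cconj l))%C).
  { intros E. apply hq'. transitivity (/ 2 * (2 * (l * Cconj l)))%C; [field|].
    rewrite E. ring. }
  transitivity ((l * Cconj l + Cconj (l * Cconj l)) * a)%C; [pushc; ring|].
  rewrite R5, P30.
  transitivity (2 * (- (4) * l * Cconj p.[0, 2]
     + 4 * l * Cconj Z * (l * Cconj p.[1, 1])
     - 4 * l ^ 3 * Cconj Z ^ 2 * Cconj p.[2, 0]))%C.
  - rewrite P20. ring [Ci2].
  - rewrite P11, P20, E02. pushc. rewrite hg. ring [Ci2].
Qed.

Theorem mainTheorem6 (N : C2 -> Prop) (F : C -> R -> R) (F320 : C) (eps : R)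
  (hN : analytic_hypersurface N)
  (hN0 : N origin)
  (hgraph : graphed_at_origin N F)
  (hF : weighted_O6 (fun z u =>
          (RtoC (F z u)
             - (z * Cconj z + F320 * z ^ 3 * Cconj z ^ 2
                  + Cconj F320 * z ^ 2 * Cconj z ^ 3))%C))
  (hF0 : locally 0%R (fun u : R => F (RtoC 0) u = 0%R))
  (heps : (0 < eps)%R)
  (hchain : Moser_chain N u_axis (- eps)%R eps) :
  F320 = RtoC 0.
Proof.
  assert (h0 : - eps < 0 < eps) by lra.
  destruct (hchain 0 h0) as (_ & _ & _ & phi &
    (Phi & hphi & hPhi & hPhi0 & N' & hN' & hNN) & x1 & y1 & x2 & y2 & hjet & hS).
  destruct hPhi as (Psi & U & V & _ & _ & hU & _ & _ & hol & _).
  destruct (hol origin hU) as [hol1 hol2].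
  destruct (holomorphic_expansion _ hol1) as [p Ep].
  destruct (holomorphic_expansion _ hol2) as [q Eq].
  assert (q00 := expansion_zero _ _ Eq). assert (p00 := expansion_zero _ _ Ep).
  change (p.[0, 0] = fst (Phi origin)) in p00.
  change (q.[0, 0] = snd (Phi origin)) in q00.
  rewrite hPhi0 in p00, q00. simpl in p00, q00.
  assert (Eax : forall s, Phi (RtoC 0, RtoC s) = phi (u_axis s)).
  { intros s. rewrite hphi. f_equal. unfold sub2, u_axis. simpl.
    f_equal; ring. }
  destruct (axis_jet_relations (fun s => phi (u_axis s))
     (coefs [p.[0, 0]; p.[0, 1]; p.[0, 2]])
     (coefs [q.[0, 0]; q.[0, 1]; q.[0, 2]]) x1 y1 x2 y2) as (A1 & A2 & A3).
  - eapply jet_ext_near; [|exact (expansion_axis_jet _ _ Ep)].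
    apply filter_forall. intros s. cbv beta. rewrite Eax. reflexivity.
  - eapply jet_ext_near; [|exact (expansion_axis_jet _ _ Eq)].
    apply filter_forall. intros s. cbv beta. rewrite Eax. reflexivity.
  - rewrite <- Eax. exact hPhi0.
  - exact q00.
  - exact hjet.
  - apply (coefficient_vanishes p q F320 x1 y1 x2 y2 p00); try assumption.
    apply (normal_image_relations N N' F F320 Phi p q); try assumption.
    revert hNN. apply filter_imp. intros P.
    replace (add2 P (u_axis 0)) with P; [trivial|].
    unfold add2, u_axis. simpl. rewrite !Cplus_0_r. apply surjective_pairing.
Qed.
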